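(* Let $\alpha>0$ be an integer. There exists a constant $C$ (independent of $f$, $I_1$, $I_2$) such that the following holds for every $f\in H^{\alpha}(\mathbb{H}_2^0)$ and all positive integers $I_1,I_2$. Let $\mathbf{A}\in\mathbb{C}^{(2I_1+1)\times(2I_2+1)}$ be the matrix of Fourier coefficients of $f$, $$\mathbf{A}(i_1,i_2)=\widehat f_{(i_1-I_1-1,\;i_2-I_2-1)},\qquad i_n=1,\dots,2I_n+1,\ n=1,2.$$ Let $S_1\ge S_2$ be positive integers with $S_n<2I_n+1$ for $n=1,2$, and let $\mathbb{I}_1\subset\{1,\dots,2I_1+1\}$ and $\mathbb{I}_2\subset\{1,\dots,2I_2+1\}$ be index sets with $|\mathbb{I}_1|=S_1$, $|\mathbb{I}_2|=S_2$. Put $\mathbf{C}=\mathbf{A}(:,\mathbb{I}_2)$, $\mathbf{R}=\mathbf{A}(\mathbb{I}_1,:)$, $\mathbf{G}=\mathbf{A}(\mathbb{I}_1,\mathbb{I}_2)$, and assume that $\mathbf{G}$ has full column rank and has maximal volume among all $S_1\times S_2$ submatrices of $\mathbf{A}$. Let $\widetilde{\mathbf{A}}=\mathbf{C}\,\mathbf{G}^\dagger\,\mathbf{R}$ and $$\widetilde{F}f(x_1,x_2)=\sum_{i_1=1}^{2I_1+1}\sum_{i_2=1}^{2I_2+1}\widetilde{\mathbf{A}}(i_1,i_2)\,e^{\iota(i_1-I_1-1)x_1}e^{\iota(i_2-I_2-1)x_2}.$$ Then $$\|\widetilde{F}f-f\|_{L^2}\le C\min\{I_1,I_2\}^{-\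alpha}|f|_\alpha+\sqrt{(2I_1+1)(2I_2+1)}\,\sqrt{1+S_2}\,\sqrt{1+\frac{S_2}{S_1-S_2+1}}\;\sigma_{S_2+1}(\mathbf{A}).$$
   Context: Here $\iota=\sqrt{-1}$, $\mathbb{H}_2^0=[-\pi,\pi]^2$, and functions on $\mathbb{H}_2^0$ are complex-valued and regarded as $2\pi$-periodic in each variable. For $(k_1,k_2)\in\mathbb{Z}^2$ the Fourier coefficient of $f$ is $$\widehat f_{(k_1,k_2)}=\Big(\frac1{2\pi}\Big)^2\int_{\mathbb{H}_2^0}f(x_1,x_2)e^{-\iota(k_1x_1+k_2x_2)}\,dx_1dx_2 .$$ $L^2(\mathbb{H}_2^0)$ is the Hilbert space with inner product $\langle f_1,f_2\rangle=(1/2\pi)^2\int_{\mathbb{H}_2^0}f_1\overline{f_2}\,dx_1dx_2$, so that $\|f\|_{L^2}^2=\sum_{(k_1,k_2)\in\mathbb{Z}^2}|\widehat f_{(k_1,k_2)}|^2$. For an integer $\alpha>0$, $H^\alpha(\mathbb{H}_2^0)$ is the set of $f\in L^2(\mathbb{H}_2^0)$ with $$\|f\|_\alpha=\Big(\sum_{(k_1,k_2)\in\mathbb{Z}^2}\big(1+\|(k_1,k_2)\|_2^{2\alpha}\big)|\widehat f_{(k_1,k_2)}|^2\Big)^{1/2}<\infty,$$ where $\|(k_1,k_2)\|_2^2=|k_1|^2+|k_2|^2$, and the semi-norm is $$|f|_\alpha=\Big(\sum_{(k_1,k_2)\in\mathbb{Z}^2}\|(k_1,k_2)\|_2^{2\alpha}|\widehat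 f_{(k_1,k_2)}|^2\Big)^{1/2}.$$ For index sets $\mathbb{I},\mathbb{J}$, $\mathbf{A}(:,\mathbb{J})$ is the submatrix of the columns indexed by $\mathbb{J}$, $\mathbf{A}(\mathbb{I},:)$ the submatrix of the rows indexed by $\mathbb{I}$, and $\mathbf{A}(\mathbb{I},\mathbb{J})$ the submatrix with those rows and columns (indices in increasing order). $\mathbf{G}^\dagger$ is the Moore--Penrose inverse of $\mathbf{G}$. $\sigma_1(\mathbf{A})\ge\sigma_2(\mathbf{A})\ge\cdots\ge 0$ are the singular values of $\mathbf{A}$. The volume of an $m\times n$ matrix $\mathbf{B}$ is the product of its singular values, $\prod_{k=1}^{\min\{m,n\}}\sigma_k(\mathbf{B})$. *)

(* Defs.v *)
From HB Require Import structures.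
From mathcomp Require Import all_boot all_order all_algebra.
From mathcomp Require Import all_classical all_reals all_analysis.
From mathcomp Require Import complex.

Set Implicit Arguments.
Unset Strict Implicit.
Unset Printing Implicit Defensive.

Import Order.TTheory GRing.Theory Num.Theory.
Import numFieldNormedType.Exports.
Import ComplexField.Normc.

Local Open Scope classical_set_scope.
Local Open Scope ring_scope.
Local Open Scope complex_scope.
Local Open Scope sesquilinear_scope.

Section Fourier.
Context {R : realType}.
Implicit Types (f : R * R -> R[i]) (k : int * int) (alpha : nat).

(* Functions are evaluated on this square only, so periodicity, which merely
   extends them to the plane, is not recorded. *)
Definition square : set (R * R) := `[- pi, pi] `*` `[- pi, pi].

Definition lebesgue2 :
    {measure set (measurableTypeR R * measurableTypeR R) -> \bar R} :=
  (@lebesgue_measure R \x @lebesgue_measure R)%E.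

Definition integral_square f : R[i] :=
  Rintegral lebesgue2 square (fun x => complex.Re (f x)) +i*
  Rintegral lebesgue2 square (fun x => complex.Im (f x)).

Definition expi (t : R) : R[i] := cos t +i* sin t.

Definition fourier_coef f k : R[i] :=
  (((2 * pi)^-1 ^+ 2 : R)%:C) *
  integral_square
    (fun x => f x * expi (- (k.1%:~R * x.1 + k.2%:~R * x.2))).

Definition L2 f : Prop :=
  [/\ measurable_fun square (fun x => complex.Re (f x)),
      measurable_fun square (fun x => complex.Im (f x)) &
      (\int[lebesgue2]_(x in square) (normc (f x) ^+ 2)%:E < +oo)%E].

Definition norm_L2 f : R :=
  Num.sqrt ((2 * pi)^-1 ^+ 2 *
            Rintegral lebesgue2 square (fun x => normc (f x) ^+ 2)).

Definition freq_norm k : R := Num.sqrt (k.1%:~R ^+ 2 + k.2%:~R ^+ 2).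

Definition sobolev alpha f : Prop :=
  L2 f /\
  (\esum_(k in [set: int * int])
     ((1 + freq_norm k ^+ (2 * alpha)) * normc (fourier_coef f k) ^+ 2)%:E
   < +oo)%E.

Definition sobolev_seminorm alpha f : R :=
  Num.sqrt (fine (\esum_(k in [set: int * int])
    (freq_norm k ^+ (2 * alpha) * normc (fourier_coef f k) ^+ 2)%:E)).

(* Rows and columns are numbered from 0, so that index i carries the
   frequency i - I. *)
Definition freq (I : nat) (i : 'I_(2 * I + 1)) : int := (i : nat)%:Z - I%:Z.

Definition fourier_mx f (I1 I2 : nat) : 'M[R[i]]_(2 * I1 + 1, 2 * I2 + 1) :=
  \matrix_(i, j) fourier_coef f (freq i, freq j).

Definition trig_sum (I1 I2 : nat) (B : 'M[R[i]]_(2 * I1 + 1, 2 * I2 + 1))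
    (x : R * R) : R[i] :=
  \sum_i \sum_j
    B i j * expi ((freq i)%:~R * x.1) * expi ((freq j)%:~R * x.2).

End Fourier.

Section Submatrices.
Context {T : Type} {m n : nat}.
Implicit Types (A : 'M[T]_(m, n)) (J : {set 'I_m}) (K : {set 'I_n}).

(* [enum_val] lists a set of ordinals in increasing order. *)
Definition cols_mx A K : 'M[T]_(m, #|K|) :=
  colsub (fun j : 'I_#|K| => enum_val j) A.

Definition rows_mx A J : 'M[T]_(#|J|, n) :=
  rowsub (fun i : 'I_#|J| => enum_val i) A.

Definition sub_mx A J K : 'M[T]_(#|J|, #|K|) :=
  mxsub (fun i : 'I_#|J| => enum_val i) (fun j : 'I_#|K| => enum_val j) A.

End Submatrices.

Section SingularValues.
Context {R : realType}.

(* The square roots of the eigenvalues, with multiplicity, of A^* A. There are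
   n of them for A of size m x n; those beyond the first minn m n vanish. *)
Definition singular_values m n (A : 'M[R[i]]_(m, n)) : seq R :=
  sort >=%R
    [seq Num.sqrt (complex.Re (spectral_diag (A^t* *m A) 0 j)) | j <- enum 'I_n].

(* Numbered from k = 1. *)
Definition singular_value m n (k : nat) (A : 'M[R[i]]_(m, n)) : R :=
  (singular_values A)`_k.-1.

Definition volume m n (A : 'M[R[i]]_(m, n)) : R :=
  \prod_(1 <= k < (minn m n).+1) singular_value k A.

End SingularValues.

Section MoorePenrose.
Context {C : numClosedFieldType}.

Definition penrose m n (G : 'M[C]_(m, n)) (X : 'M[C]_(n, m)) : bool :=
  [&& G *m X *m G == G, X *m G *m X == X,
      (G *m X)^t* == G *m X & (X *m G)^t* == X *m G].

Let trC_mul m n p (A : 'M[C]_(m, n)) (B : 'M[C]_(n, p)) :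
  (A *m B)^t* = B^t* *m A^t*.
Proof. by rewrite trmx_mul map_mxM. Qed.

Lemma gram_unit m n (A : 'M[C]_(m, n)) :
  row_free A -> A *m A^t* \in unitmx.
Proof.
move=> fA; rewrite -row_free_unit -kermx_eq0; apply/eqP/row_matrixP => i.
rewrite row0; set x := row i _.
have : x *m (A *m A^t* ) = 0 by rewrite /x -row_mul mulmx_ker row0.
move/(congr1 (mulmx^~ (x^t* ))).
have -> : x *m (A *m A^t* ) *m x^t* = (x *m A) *m (x *m A)^t*.
  by rewrite trC_mul !mulmxA.
rewrite mul0mx => /matrixP/(_ 0 0).
rewrite -dotmxE mxE => /eqP; rewrite dnorm_eq0 => /eqP xA0.
by apply: (row_free_inj fA); rewrite xA0 mul0mx.
Qed.

Lemma penrose_factor m r n (B : 'M[C]_(m, r)) (D : 'M[C]_(r, n)) :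
  row_full B -> row_free D -> exists X, penrose (B *m D) X.
Proof.
move=> fB /gram_unit uD.
have uB : B^t* *m B \in unitmx.
  have := @gram_unit _ _ (B^t* ).
  by rewrite trmxCK; apply; rewrite /row_free mxrank_map mxrank_tr.
pose iD := invmx (D *m D^t* ); pose iB := invmx (B^t* *m B).
have hD : iD^t* = iD by rewrite /iD trmx_inv map_invmx trC_mul trmxCK.
have hB : iB^t* = iB by rewrite /iB trmx_inv map_invmx trC_mul trmxCK.
have DX : D *m (D^t* *m iD) = 1%:M by rewrite mulmxA mulmxV.
have XB : iB *m B^t* *m B = 1%:M by rewrite -mulmxA mulVmx.
pose X := D^t* *m iD *m (iB *m B^t* ).
have GX : B *m D *m X = B *m (iB *m B^t* ).
  by rewrite /X mulmxA -(mulmxA B) DX mulmx1.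
have XG : X *m (B *m D) = D^t* *m iD *m D.
  by rewrite /X -mulmxA (mulmxA _ B) XB mul1mx.
exists X; apply/and4P; split; apply/eqP.
- by rewrite GX mulmxA -(mulmxA B) XB mulmx1.
- by rewrite XG /X mulmxA -(mulmxA _ D) DX mulmx1.
- by rewrite GX !trC_mul trmxCK hB mulmxA.
- by rewrite XG !trC_mul trmxCK hD mulmxA.
Qed.

Lemma penrose_exists m n (G : 'M[C]_(m, n)) : exists X, penrose G X.
Proof.
rewrite -[G]mulmx_base.
exact: penrose_factor (col_base_full G) (row_base_free G).
Qed.

Lemma penrose_unique m n (G : 'M[C]_(m, n)) X Y :
  penrose G X -> penrose G Y -> X = Y.
Proof.
move=> /and4P[/eqP X1 /eqP X2 /eqP X3 /eqP X4].
move=> /and4P[/eqP Y1 /eqP Y2 /eqP Y3 /eqP Y4].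
have GE : G *m X = G *m Y.
  rewrite -X3 -{1}Y1 -(mulmxA (G *m Y)) trC_mul X3 Y3.
  by rewrite mulmxA X1.
have EG : X *m G = Y *m G.
  rewrite -X4 -{1}Y1 -(mulmxA G) mulmxA trC_mul X4 Y4.
  by rewrite -mulmxA (mulmxA G) X1.
by rewrite -X2 EG -mulmxA GE mulmxA Y2.
Qed.

Definition moore_penrose m n (G : 'M[C]_(m, n)) : 'M[C]_(n, m) :=
  xchoose (penrose_exists G).

Lemma moore_penroseP m n (G : 'M[C]_(m, n)) : penrose G (moore_penrose G).
Proof. exact: xchooseP. Qed.

End MoorePenrose.

(* Main.v *)
Require Import Defs.
From mathcomp Require Import all_boot all_order all_algebra.
From mathcomp Require Import all_classical all_reals all_analysis.
From mathcomp Require Import measurable_realfun.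
From mathcomp Require Import complex ring lra zify.

Set Implicit Arguments.
Unset Strict Implicit.
Unset Printing Implicit Defensive.

Import Order.TTheory GRing.Theory Num.Theory.
Local Open Scope ring_scope.

(** The characters exp (i k.x) are orthonormal for the normalised inner
    product on the square.  Hence the squared distance from f to a
    trigonometric polynomial with frequencies in the box |k_1| <= I1,
    |k_2| <= I2 is the sum of two terms ([norm_L2_distance]): the mass of the
    Fourier coefficients of f outside the box, and the squared Frobenius norm
    of the difference of the coefficient matrices inside the box.  The square
    root of a sum of two squares is at most the sum of their roots, so the two
    terms can be bounded separately, and C = 1 works.

    Outside the box |k| >= min (I1, I2), so the first term is at most
    min (I1, I2)^(-2 alpha) |f|_alpha^2 ([truncation_error]).  This uses the
    hard half of Parseval's identity, |f|^2 <= sum_k |f^_k|^2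
    ([parseval_le]), that is, the density of trigonometric polynomials in L^2
    ([trig_poly_dense]).  Density comes from measure theory alone.  The bounded
    functions which are L^2 limits of members of an algebra of bounded
    functions are again closed under products and under dominated pointwise
    limits; so the sets whose indicator is such a limit form a sigma-algebra
    ([sigma_algebra_approximable]).  The polynomials (1 - u^n)^(n 2^n) converge
    to the indicator of {u < 1/2} for u in [0, 1] ([cvg_step_poly]), which puts
    the level sets of every function of the algebra in that sigma-algebra
    ([approximable_lt]).  Level sets of the cosine and sine of a coordinate
    generate the Borel sets up to a null line, and simple functions do the
    rest.

    Inside the box, each of the (2 I1 + 1)(2 I2 + 1) entries of A - C G^+ R is
    bounded by sqrt (1 + r) sqrt (1 + r / (m - r + 1)) sigma_(r+1) (A), where G
    is m x r of maximal volume ([max_volume_entry_bound]).  The square of the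
    volume of a tall matrix is its Gram determinant.  Border the m x r matrix G
    by the row and the column of the entry under study, and call H the
    (m+1) x (r+1) matrix obtained.
    - The residual entry e satisfies |e|^2 vol (G)^2 <= vol (H)^2, by a Schur
      complement ([det_gram_add_row]).
    - Deleting one column of H multiplies the Gram determinant by a diagonal
      entry of the inverse of gram H, so these r + 1 minors add up to
      vol (H)^2 tr ((gram H)^-1).
    - A column-deleted matrix has m + 1 rows; its m x r row-deleted submatrices
      have squared volumes which add up to m + 1 - r times its own
      ([det_gram_delete_rows]), and each is at most vol (G)^2 by maximality.
    Together |e|^2 tr ((gram H)^-1) (m + 1 - r) <= (r + 1)(m + 1), while every
    eigenvalue of gram H is at least 1 / tr ((gram H)^-1), and sigma_(r+1) (A)^2
    is at least the smallest of these eigenvalues by the minimax principle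
    ([spectral_diag_count]). *)

Section LinearAlgebra.
Import ComplexField.Normc.
Local Open Scope complex_scope.
Local Open Scope sesquilinear_scope.
Local Notation "z ^*" := (Num.conj z) : complex_scope.

(** * Determinants under rank-one updates *)
Section Det.
Variable F : fieldType.

Lemma det_schur n (a : 'M[F]_1) (v : 'rV[F]_n) (w : 'cV[F]_n) (M : 'M[F]_n) :
  M \in unitmx ->
  \det (block_mx a v w M) = (a - v *m invmx M *m w) 0 0 * \det M.
Proof.
move=> uM.
have -> : block_mx a v w M =
    block_mx (a - v *m invmx M *m w) v 0 M *m
    block_mx 1%:M 0 (invmx M *m w) 1%:M.
  rewrite mulmx_block !(mulmx0, mul0mx, mulmx1, add0r) mulmxA subrK.
  by rewrite mulmxA mulmxV// mul1mx.
by rewrite det_mulmx det_ublock det_lblock !det1 !mulr1 det_mx11.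
Qed.

(** Both sides are the determinant of the bordered matrix with first row (1, v)
    and first column (1, -u): eliminating the corner 1 gives the left-hand side,
    eliminating M the right-hand side. *)
Lemma det_add_rank1 n (M : 'M[F]_n) (u : 'cV[F]_n) (v : 'rV[F]_n) :
  M \in unitmx ->
  \det (M + u *m v) = (1 + (v *m invmx M *m u) 0 0) * \det M.
Proof.
move=> uM; transitivity (\det (block_mx 1%:M v (- u) M)); last first.
  by rewrite det_schur// mulmxN opprK !mxE.
have -> : block_mx 1%:M v (- u) M =
    block_mx 1%:M 0 (- u) 1%:M *m block_mx 1%:M v 0 (M + u *m v).
  rewrite mulmx_block !(mulmx0, mul0mx, mulmx1, mul1mx, addr0, add0r).
  by congr block_mx; rewrite mulNmx addrC addrK.
by rewrite det_mulmx det_lblock det_ublock !det1 !mul1r.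
Qed.

Lemma det_mxsub_inj r s (p : 'I_r -> 'I_s) (M : 'M[F]_s) :
  r = s -> injective p -> \det (mxsub p p M) = \det M.
Proof.
move=> ers; subst s => pI.
have -> : mxsub p p M = row_perm (perm.perm pI) (col_perm (perm.perm pI) M).
  by apply/matrixP => i j; rewrite !mxE !perm.permE.
rewrite row_permE col_permE !det_mulmx !det_perm mulrA mulrAC -signr_addb.
by rewrite perm.odd_permV addbb mul1r.
Qed.

End Det.

(** * Gram matrices and the residual of a maximal-volume submatrix *)
Section Gram.
Variable C : numClosedFieldType.

Lemma adjmx_mul m n p (A : 'M[C]_(m, n)) (B : 'M[C]_(n, p)) :
  (A *m B)^t* = B^t* *m A^t*.
Proof. by rewrite trmx_mul map_mxM. Qed.

Definition gram m n (A : 'M[C]_(m, n)) : 'M[C]_n := A^t* *m A.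

Lemma gram_adj m n (A : 'M[C]_(m, n)) : (gram A)^t* = gram A.
Proof. by rewrite /gram adjmx_mul trmxCK. Qed.

Lemma gramE m n (A : 'M[C]_(m, n)) i j :
  gram A i j = \sum_k (A k i)^* * A k j.
Proof. by rewrite mxE; apply: eq_bigr => k _; rewrite !mxE. Qed.

Lemma gramM m n p (A : 'M[C]_(m, n)) (B : 'M[C]_(n, p)) :
  gram (A *m B) = B^t* *m gram A *m B.
Proof. by rewrite /gram adjmx_mul !mulmxA. Qed.

Lemma gram_colsub m n r (A : 'M[C]_(m, n)) (g : 'I_r -> 'I_n) :
  gram (colsub g A) = mxsub g g (gram A).
Proof.
apply/matrixP => i j; rewrite gramE mxE gramE.
by apply: eq_bigr => k _; rewrite !mxE.
Qed.

Lemma gram11 m (A : 'cV[C]_m) : gram A 0 0 = \sum_k `|A k 0| ^+ 2.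
Proof. by rewrite gramE; apply: eq_bigr => k _; rewrite normCK mulrC. Qed.

Lemma gram11_ge0 m (A : 'cV[C]_m) : 0 <= gram A 0 0.
Proof. by rewrite gram11 sumr_ge0// => k _; rewrite exprn_ge0. Qed.

Lemma gram_block m n p (A : 'M[C]_(m, n)) (B : 'M[C]_(m, p)) :
  gram (row_mx A B) = block_mx (gram A) (A^t* *m B) (B^t* *m A) (gram B).
Proof. by rewrite /gram tr_row_mx map_col_mx mul_col_row. Qed.

Lemma gram_quad m n (A : 'M[C]_(m, n)) (x : 'rV[C]_n) :
  0 <= (x *m gram A *m x^t*) 0 0.
Proof. by have := gram11_ge0 (A *m x^t*); rewrite gramM trmxCK. Qed.

Lemma gram_spectral m n (A : 'M[C]_(m, n)) :
  gram A = (spectralmx (gram A))^t* *m diag_mx (spectral_diag (gram A))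
           *m spectralmx (gram A).
Proof.
have nG : gram A \is normalmx by apply/normalmxP; rewrite gram_adj.
rewrite {1}(orthomx_spectralP nG).
by rewrite invmx_unitary ?spectral_unitarymx.
Qed.

Lemma diag_quad n (d y : 'rV[C]_n) :
  (y *m diag_mx d *m y^t*) 0 0 = \sum_j d 0 j * `|y 0 j| ^+ 2.
Proof.
rewrite mxE; apply: eq_bigr => j _.
rewrite mul_mx_diag !mxE normCK mulrAC mulrC mulrA; ring.
Qed.

Lemma spectral_gram_ge0 m n (A : 'M[C]_(m, n)) j :
  0 <= spectral_diag (gram A) 0 j.
Proof.
set P := spectralmx (gram A); set d := spectral_diag _.
have uP : P *m P^t* = 1%:M by apply/unitarymxP; rewrite spectral_unitarymx.
have := gram_quad A (delta_mx 0 j *m P).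
rewrite gram_spectral -/P -/d adjmx_mul !mulmxA.
rewrite -(mulmxA (delta_mx 0 j)) uP mulmx1.
rewrite -(mulmxA (_ *m diag_mx d)) uP mulmx1.
rewrite diag_quad (bigD1 j)//= big1 ?addr0; last first.
  by move=> i ij; rewrite !mxE (negbTE ij) normr0 expr0n mulr0.
by rewrite !mxE !eqxx normr1 expr1n mulr1.
Qed.

Lemma det_gram m n (A : 'M[C]_(m, n)) :
  \det (gram A) = \prod_j spectral_diag (gram A) 0 j.
Proof.
rewrite {1}gram_spectral !det_mulmx mulrAC -det_mulmx.
rewrite -invmx_unitary ?spectral_unitarymx// mulVmx ?spectral_unit//.
by rewrite det1 mul1r det_diag.
Qed.

Lemma det_gram_ge0 m n (A : 'M[C]_(m, n)) : 0 <= \det (gram A).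
Proof. by rewrite det_gram prodr_ge0// => j _; exact: spectral_gram_ge0. Qed.

Lemma inv_gram_adj m n (A : 'M[C]_(m, n)) :
  (invmx (gram A))^t* = invmx (gram A).
Proof. by rewrite trmx_inv map_invmx gram_adj. Qed.

Lemma inv_gram_quad m n (A : 'M[C]_(m, n)) (x : 'rV[C]_n) :
  gram A \in unitmx -> 0 <= (x *m invmx (gram A) *m x^t*) 0 0.
Proof.
move=> uG; have := gram_quad A (x *m invmx (gram A)).
rewrite adjmx_mul inv_gram_adj; move: (gram A) uG => M uM.
by rewrite mulmxA -(mulmxA _ _ M) mulVmx// mulmx1.
Qed.

Lemma gram_row_sum m n (A : 'M[C]_(m, n)) :
  gram A = \sum_i (row i A)^t* *m row i A.
Proof.
apply/matrixP => a b; rewrite gramE summxE; apply: eq_bigr => i _.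
by rewrite mxE big_ord1 !mxE.
Qed.

(** Rows outside K are zeroed instead of removed: the Gram matrix is that of the
    row submatrix, and the dimensions do not depend on K. *)
Definition mask_rows m n (K : {set 'I_m}) (A : 'M[C]_(m, n)) : 'M[C]_(m, n) :=
  \matrix_(i, j) (if i \in K then A i j else 0).

Lemma adj_mask m n p (K : {set 'I_m}) (A : 'M[C]_(m, n)) (B : 'M[C]_(m, p)) :
  (mask_rows K A)^t* *m mask_rows K B = \sum_(i in K) (row i A)^t* *m row i B.
Proof.
apply/matrixP => a b; rewrite mxE summxE [RHS]big_mkcond; apply: eq_bigr => i _.
rewrite !mxE; case: ifP => _; last by rewrite mulr0.
by rewrite big_ord1 !mxE.
Qed.

Lemma gram_mask m n (K : {set 'I_m}) (A : 'M[C]_(m, n)) :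
  gram (mask_rows K A) = \sum_(i in K) (row i A)^t* *m row i A.
Proof. exact: adj_mask. Qed.

Lemma gram_maskD1 m n (K : {set 'I_m}) i (A : 'M[C]_(m, n)) : i \in K ->
  gram (mask_rows K A) =
  gram (mask_rows (K :\ i) A) + (row i A)^t* *m row i A.
Proof. by move=> iK; rewrite !gram_mask (big_setD1 i)//= addrC. Qed.

(** Let G be the Gram matrix of the rows in K.  Deleting a row a multiplies its
    determinant by 1 - a G^-1 a', where a' is the adjoint of a, and the numbers
    a G^-1 a' add up to the trace of the identity.  Equality can only fail when
    G is singular, and then the left-hand side is zero. *)
Lemma det_gram_delete_rows m n (K : {set 'I_m}) (A : 'M[C]_(m, n)) :
  (n <= #|K|)%N ->
  (#|K| - n)%:R * \det (gram (mask_rows K A)) <=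
  \sum_(i in K) \det (gram (mask_rows (K :\ i) A)).
Proof.
move=> nK; set B := mask_rows K A.
have [uG|] := boolP (gram B \in unitmx); last first.
  rewrite unitmxE unitfE negbK => /eqP ->; rewrite mulr0.
  by apply: sumr_ge0 => i _; exact: det_gram_ge0.
have E i : i \in K -> \det (gram (mask_rows (K :\ i) A)) =
    (1 - (row i A *m invmx (gram B) *m (row i A)^t*) 0 0) * \det (gram B).
  move=> iK; have -> : gram (mask_rows (K :\ i) A) =
     gram B + (- (row i A)^t*) *m row i A.
    by rewrite /B (gram_maskD1 _ iK) mulNmx addrK.
  by rewrite det_add_rank1// mulmxN; congr ((1 + _) * _); rewrite mxE.
rewrite (eq_bigr _ E) -mulr_suml sumrB sumr_const.
have -> : \sum_(i in K) (row i A *m invmx (gram B) *m (row i A)^t*) 0 0 = n%:R.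
  rewrite -[RHS]/(n%:R : C) -(mxtrace1 C n) -(mulVmx uG) {2}/B gram_mask.
  rewrite mulmx_sumr raddf_sum/=; apply: eq_bigr => i _.
  by rewrite mulmxA mxtrace_mulC mulmxA /mxtrace big_ord1.
by rewrite natrB.
Qed.

Lemma minor_gram m n (A : 'M[C]_(m, n.+1)) j :
  cofactor (gram A) j j = \det (gram (col' j A)).
Proof.
rewrite /cofactor -signr_odd oddD addbb expr0 mul1r; congr (\det _).
by apply/matrixP => a b; rewrite mxE mxE !gramE; apply: eq_bigr => i _; rewrite !mxE.
Qed.

(** With A' the adjoint of A and L = A (gram A)^-1, one has x = (x A') L and
    gram L = (gram A)^-1; apply Cauchy-Schwarz in each coordinate of (x A') L.
    The bound says that no eigenvalue of gram A is below 1 / tr ((gram A)^-1). *)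
Lemma gram_lower_bound m n (A : 'M[C]_(m, n)) (x : 'rV[C]_n) :
  gram A \in unitmx ->
  (x *m x^t*) 0 0 <= \tr (invmx (gram A)) * (x *m gram A *m x^t*) 0 0.
Proof.
move=> uG; set M := gram A; pose L := A *m invmx M; pose y := x *m A^t*.
have xy : x = y *m L by rewrite /y /L mulmxA -(mulmxA x) -/(gram A) mulmxK.
have -> : x *m M *m x^t* = y *m y^t*.
  by rewrite /y adjmx_mul trmxCK /M /gram !mulmxA.
have -> : \tr (invmx M) = \sum_j \sum_k `|L k j| ^+ 2.
  have -> : invmx M = gram L.
    rewrite /L gramM -/M inv_gram_adj -mulmxA mulmxV// mulmx1//.
  by rewrite /mxtrace; apply: eq_bigr => j _; rewrite gramE;
     apply: eq_bigr => k _; rewrite normCK mulrC.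
have nrm p (z : 'rV[C]_p) : (z *m z^t*) 0 0 = \sum_k `|z 0 k| ^+ 2.
  by rewrite mxE; apply: eq_bigr => k _; rewrite !mxE normCK.
rewrite nrm mulr_suml; apply: ler_sum => j _.
have := CauchySchwarz (@dotmx C m) y ((col j L)^t*).
case=> + _; rewrite /= !dotmxE trmxCK.
have -> : (y *m col j L) 0 0 = x 0 j 
  by rewrite [in RHS]xy mxE [RHS]mxE; apply: eq_bigr => k _; rewrite [col j L k 0]mxE.
move=> /le_trans; apply; rewrite mulrC ler_wpM2r//.
  by rewrite nrm sumr_ge0// => k _; rewrite exprn_ge0.
rewrite mxE le_eqVlt; apply/orP; left; apply/eqP; apply: eq_bigr => k _.
by rewrite !mxE normCK mulrC.
Qed.

(** One half of the minimax principle.  If fewer than s eigenvalues of gram A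
    reached t, some nonzero x in the s-dimensional row space of W would be
    orthogonal to all their eigenvectors, and the quadratic form at x would be
    smaller than t |x|^2. *)
Lemma spectral_diag_count m n s (A : 'M[C]_(m, n)) (W : 'M[C]_(s, n)) t :
  t \is Num.real -> W \is unitarymx ->
  (forall x : 'rV[C]_s,
     t * (x *m x^t*) 0 0 <= (x *m W *m gram A *m (x *m W)^t*) 0 0) ->
  (s <= #|[set j | (t <= spectral_diag (gram A) 0 j)%R]|)%N.
Proof.
move=> tR uW hW; rewrite leqNgt; apply/negP.
set B := [set j | _]; pose P := spectralmx (gram A).
pose d := spectral_diag (gram A).
move=> ltBs.
have uP : P *m P^t* = 1%:M by apply/unitarymxP; rewrite spectral_unitarymx.
pose Z := colsub (fun k : 'I_#|B| => enum_val k) (W *m P^t*).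
have /rowV0Pn[x xZ x0] : kermx Z != 0.
  rewrite kermx_eq0 -row_leq_rank -ltnNge.
  by apply: leq_ltn_trans ltBs; exact: rank_leq_col.
pose z := x *m W *m P^t*.
have zB j : j \in B -> z 0 j = 0.
  move=> jB; transitivity ((x *m Z) 0 (enum_rank_in jB j)); last first.
    by rewrite (sub_kermxP xZ) mxE.
  rewrite /z -mulmxA mxE [RHS]mxE; apply: eq_bigr => k _.
  by rewrite [Z _ _]mxE enum_rankK_in.
have xz : (x *m x^t*) 0 0 = \sum_j `|z 0 j| ^+ 2.
  have -> : x *m x^t* = z *m z^t*.
    rewrite /z !adjmx_mul trmxCK !mulmxA -(mulmxA (x *m W)).
    rewrite -invmx_unitary ?spectral_unitarymx// mulVmx ?spectral_unit// mulmx1.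
    by rewrite -(mulmxA x) (unitarymxP uW) mulmx1.
  by rewrite mxE; apply: eq_bigr => k _; rewrite !mxE normCK.
have := hW x; rewrite gram_spectral -/P -/d !mulmxA.
have -> : x *m W *m P^t* *m diag_mx d *m P *m (x *m W)^t* =
    z *m diag_mx d *m z^t*.
  by rewrite -/z /z [in RHS]adjmx_mul trmxCK !mulmxA.
rewrite diag_quad xz.
have xn0 : (x *m x^t*) 0 0 != 0 by rewrite -dotmxE dnorm_eq0.
have T j : d 0 j * `|z 0 j| ^+ 2 <= t * `|z 0 j| ^+ 2
    ?= iff (z 0 j == 0).
  have [jB|jB] := boolP (j \in B).
    by rewrite zB// normr0 expr0n !mulr0 eqxx; exact/leifP.
  have dt : d 0 j < t.
    move: jB; rewrite inE real_leNgt ?negbK//.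
    by apply: ger0_real; exact: spectral_gram_ge0.
  apply/leifP; case: eqP => [->|/eqP z0]; first by rewrite normr0 expr0n !mulr0.
  by rewrite ltr_pM2r// exprn_gt0// normr_gt0.
have [le1 E] := leif_sum (fun j (_ : true) => T j).
rewrite mulr_sumr => tx.
have /eqP := le_anti (introT andP (conj le1 tx)).
rewrite E => /forall_inP z0.
by case/negP: xn0; rewrite xz big1// => j _; rewrite (eqP (z0 j isT)) normr0 expr0n.
Qed.

Lemma mask_rowsE m n (K : {set 'I_m}) (A : 'M[C]_(m, n)) i j :
  mask_rows K A i j = if i \in K then A i j else 0.
Proof. by rewrite mxE. Qed.

Lemma mask_rowsM m n p (K : {set 'I_m}) (A : 'M[C]_(m, n)) (B : 'M[C]_(n, p)) :
  mask_rows K (A *m B) = mask_rows K A *m B.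
Proof.
apply/matrixP => i j; rewrite mask_rowsE !mxE; case: ifP => iK.
  by apply: eq_bigr => k _; rewrite mask_rowsE iK.
by rewrite big1// => k _; rewrite mask_rowsE iK mul0r.
Qed.

Lemma mask_rows_mx m n p (K : {set 'I_m}) (A : 'M[C]_(m, n)) (B : 'M[C]_(m, p)) :
  mask_rows K (row_mx A B) = row_mx (mask_rows K A) (mask_rows K B).
Proof.
apply/matrixP => i j; rewrite mask_rowsE [RHS]mxE [row_mx A B i j]mxE.
by case: (fintype.split j) => k; rewrite mask_rowsE.
Qed.

Lemma quad_mask_le m n (K : {set 'I_m}) (A : 'M[C]_(m, n)) (x : 'rV[C]_n) :
  (x *m gram (mask_rows K A) *m x^t*) 0 0 <= (x *m gram A *m x^t*) 0 0.
Proof.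
rewrite gram_mask gram_row_sum !mulmx_sumr !mulmx_suml !summxE.
rewrite [leRHS](bigID (mem K))/= lerDl sumr_ge0// => i _.
have -> : x *m ((row i A)^t* *m row i A) *m x^t* = gram (row i A *m x^t*).
  by rewrite gramM trmxCK /gram !mulmxA.
exact: gram11_ge0.
Qed.

(** By orthogonality on J the off-diagonal block of the Gram matrix of (e, A) on
    i0 |: J only sees row i0, and the Schur complement gives exactly
    (sum_(k in J) |e_k|^2) det (gram A_(i0 |: J)) + |e_i0|^2 det (gram A_J).
    Either term alone dominates the left-hand side, according to whether i lies
    in J or is i0. *)
Lemma det_gram_add_row m n (J : {set 'I_m}) i0 (A : 'M[C]_(m, n)) (e : 'cV[C]_m) :
  i0 \notin J -> gram (mask_rows J A) \in unitmx ->
  (mask_rows J A)^t* *m e = 0 ->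
  forall i, i \in i0 |: J ->
  `|e i 0| ^+ 2 * \det (gram (mask_rows J A)) <=
  \det (gram (mask_rows (i0 |: J) (row_mx e A))).
Proof.
move=> i0J uG orth i iK; set K := i0 |: J.
set c := row i0 A; set G := gram _ in uG *; pose M := gram (mask_rows K A).
have KJ : K :\ i0 = J by rewrite setU1K.
have ME : M = G + c^t* *m c by rewrite /M (@gram_maskD1 _ _ _ i0) ?setU11// KJ.
have dG : 0 < \det G.
  by rewrite lt0r det_gram_ge0 andbT -unitfE -unitmxE.
have dGM : \det G <= \det M.
  rewrite ME det_add_rank1// mulrDl mul1r lerDl mulr_ge0 ?det_gram_ge0//.
  exact: inv_gram_quad.
have uM : M \in unitmx by rewrite unitmxE unitfE gt_eqF// (lt_le_trans dG).
have orthJ : (mask_rows J A)^t* *m mask_rows J e = 0.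
  rewrite -[RHS]orth; apply/matrixP => a b; rewrite mxE [RHS]mxE.
  apply: eq_bigr => k _; rewrite !mxE; case: ifP => // _.
  by rewrite conjC0 !mul0r.
have Ae : (mask_rows K A)^t* *m mask_rows K e = e i0 0 *: c^t*.
  rewrite adj_mask big_setU1//= -adj_mask orthJ addr0.
  apply/matrixP => a b; rewrite ord1 mxE big_ord1 !mxE.
  by rewrite mulrC.
have eA : (mask_rows K e)^t* *m mask_rows K A = (e i0 0)^* *: c.
  apply: (can_inj (@trmxCK _ _ _)); rewrite adjmx_mul trmxCK Ae.
  by apply/matrixP => a b; rewrite !mxE rmorphM/= conjCK.
have ee : gram (mask_rows K e) 0 0 = `|e i0 0| ^+ 2 + \sum_(k in J) `|e k 0| ^+ 2.
  rewrite gram11 -(big_setU1 _ i0J (F := fun k => `|e k 0| ^+ 2))/= [RHS]big_mkcond.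
  apply: eq_bigr => k _; rewrite mask_rowsE -/K; case: ifP => // _.
  by rewrite normr0 expr0n.
have dGE : \det G = (1 - (c *m invmx M *m c^t*) 0 0) * \det M.
  have -> : G = M + (- c^t*) *m c by rewrite ME mulNmx addrK.
  by rewrite det_add_rank1// mulmxN; congr ((1 + _) * _); rewrite mxE.
have -> : \det (gram (mask_rows K (row_mx e A))) =
    (\sum_(k in J) `|e k 0| ^+ 2) * \det M + `|e i0 0| ^+ 2 * \det G.
  rewrite mask_rows_mx gram_block Ae eA det_schur//.
  rewrite mxE ee dGE -!scalemxAl -scalemxAr.
  move: (c *m _ *m _) => q; rewrite !mxE.
  rewrite mulrA [X in X * q 0 0]mulrC -normCK; ring.
move: iK; rewrite /K !inE => /orP[/eqP ->|iJ].
  rewrite lerDr mulr_ge0 ?det_gram_ge0//.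
  by apply: sumr_ge0 => k _; rewrite exprn_ge0.
apply: ler_wpDr; first by rewrite mulr_ge0 ?exprn_ge0// ltW.
rewrite ler_pM ?exprn_ge0 ?det_gram_ge0//.
rewrite (bigD1 i)//= lerDl.
by apply: sumr_ge0 => k _; rewrite exprn_ge0.
Qed.

Definition extend_fun n r (j : 'I_n) (g : 'I_r -> 'I_n) (a : 'I_(1 + r)) :=
  if fintype.split a is inr b then g b else j.

Lemma extend_fun_inj n r (j : 'I_n) (g : 'I_r -> 'I_n) :
  injective g -> (forall b, g b != j) -> injective (extend_fun j g).
Proof.
move=> gI gj a b; rewrite /extend_fun.
case: (splitP a) => [a' ea|a' ea]; case: (splitP b) => [b' eb|b' eb].
- by move=> _; apply: val_inj; rewrite /= ea eb !ord1.
- by move=> /esym/eqP; rewrite (negbTE (gj _)).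
- by move=> /eqP; rewrite (negbTE (gj _)).
- by move=> /gI ab; apply: val_inj; rewrite /= ea eb ab.
Qed.

Lemma colsub_extend m n r (j : 'I_n) (g : 'I_r -> 'I_n) (A : 'M[C]_(m, n)) :
  colsub (extend_fun j g) A = row_mx (col j A) (colsub g A).
Proof.
apply/matrixP => i a; rewrite mxE [RHS]mxE /extend_fun.
by case: (fintype.split a) => b; rewrite mxE.
Qed.

(** Let H consist of the columns g and j of A on the rows of J and one more row,
    which is i unless i lies in J.  By [det_gram_add_row] the residual e i is
    controlled by det (gram H); by maximality so are the minors of H, whose sum
    over the columns is det (gram H) tr ((gram H)^-1).  The number t is
    1 / tr ((gram H)^-1), or 0 when H has dependent columns. *)
Lemma maxvol_residual m n r (A : 'M[C]_(m, n)) (J : {set 'I_m})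
    (g : 'I_r -> 'I_n) (x : 'cV[C]_r) i j :
  let V := \det (gram (mask_rows J (colsub g A))) in
  let e := col j A - colsub g A *m x in
  (r <= #|J| < m)%N -> injective g -> (forall b, g b != j) ->
  V != 0 ->
  (forall (K : {set 'I_m}) (h : 'I_r -> 'I_n), #|K| = #|J| -> injective h ->
     \det (gram (mask_rows K (colsub h A))) <= V) ->
  (mask_rows J (colsub g A))^t* *m e = 0 ->
  exists2 t : C, 0 <= t /\ (r < #|[set k | (t <= spectral_diag (gram A) 0 k)%R]|)%N &
    `|e i 0| ^+ 2 * (#|J| - r + 1)%:R <= (1 + r)%:R * (#|J| + 1)%:R * t.
Proof.
move=> V e /andP[rJ Jm] gI gj V0 maxV orth.
have uG : gram (mask_rows J (colsub g A)) \in unitmx.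
  by rewrite unitmxE unitfE.
have Vgt0 : 0 < V by rewrite lt0r V0 det_gram_ge0.
have [i0 i0J iK] : exists2 i0, i0 \notin J & i \in i0 |: J.
  have [iJ|iJ] := boolP (i \in J); last by exists i => //; rewrite setU11.
  have /subsetPn[k _ kJ] : ~~ ([set: 'I_m] \subset J).
    by apply/negP => /subset_leq_card; rewrite cardsT card_ord leqNgt Jm.
  by exists k => //; rewrite setU1r.
set K := i0 |: J in iK; have cK : #|K| = #|J|.+1 by rewrite cardsU1 i0J.
pose h := extend_fun j g; have hI : injective h by exact: extend_fun_inj.
pose H := mask_rows K (colsub h A).
(* Subtracting combinations of the other columns turns the new column into e
   and keeps the Gram determinant. *)
have eD : `|e i 0| ^+ 2 * V <= \det (gram H).
  have := det_gram_add_row i0J uG orth iK; rewrite -/V -/K => /le_trans; apply.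
  have HE : H = mask_rows K (row_mx e (colsub g A)) *m block_mx 1%:M 0 x 1%:M.
    rewrite -mask_rowsM; congr mask_rows; rewrite colsub_extend mul_row_block.
    by rewrite !mulmx1 mulmx0 add0r /e subrK.
  rewrite HE gramM !det_mulmx tr_block_mx map_block_mx det_lblock.
  rewrite trmx0 map_mx0 det_ublock !det1 !trmx1 !map_mx1 !det1.
  by rewrite !mulr1 mul1r.
have nr : (r < n)%N.
  rewrite -[r.+1]card_ord -[n]card_ord; exact: leq_card hI.
have [D0|D0] := eqVneq (\det (gram H)) 0.
  (* Dependent columns: the residual entry is zero. *)
  exists 0; last first.
    rewrite mulr0; move: eD; rewrite D0 pmulr_lle0//.
    move=> le0; have /eqP -> : `|e i 0| ^+ 2 == 0 by rewrite eq_le le0 exprn_ge0.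
    by rewrite mul0r.
  split=> //; apply: leq_trans nr _; rewrite -[leqLHS]card_ord -cardsT.
  by apply/subset_leq_card/fintype.subsetP => k _; rewrite inE spectral_gram_ge0.
have uH : gram H \in unitmx by rewrite unitmxE unitfE.
pose tau := \tr (invmx (gram H)).
have tauE : \det (gram H) * tau =
    \sum_a \det (gram (mask_rows K (colsub (h \o lift a) A))).
  rewrite /tau /invmx uH mxtraceZ mulVKf//.
  apply: eq_bigr => a _; rewrite mxE minor_gram; congr (\det (gram _)).
  by apply/matrixP => k b; rewrite !mxE.
(* Each column-deleted minor is compared with V through its row-deleted
   submatrices, which have the size of the maximal-volume one. *)
have tau_bnd : (#|J|.+1 - r)%:R * (\det (gram H) * tau) <=
    (1 + r)%:R * (#|J|.+1)%:R * V.
  have -> : (1 + r)%:R = \sum_(a < 1 + r) 1 :> C by rewrite sumr_const card_ord.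
  rewrite tauE mulr_sumr -mulrA mulr_suml; apply: ler_sum => a _; rewrite mul1r.
  have := @det_gram_delete_rows _ _ K (colsub (h \o lift a) A).
  rewrite cK => /(_ (leqW rJ)) => /le_trans; apply.
  rewrite -cK mulr_natl -sumr_const; apply: ler_sum => k kK.
  apply: maxV; first by apply: succn_inj; rewrite -cK (cardsD1 k K) kK.
  by move=> b c /hI /lift_inj.
have tau0 : 0 < tau.
  rewrite lt0r; apply/andP; split; last first.
    rewrite -(pmulr_rge0 _ (_ : 0 < \det (gram H))); last by rewrite lt0r D0 det_gram_ge0.
    by rewrite tauE sumr_ge0// => a _; exact: det_gram_ge0.
  apply/negP => /eqP t0.
  have := @gram_lower_bound _ _ H (delta_mx 0 ord0) uH.
  rewrite -/tau t0 mul0r mxE (bigD1 ord0)//= big1 => [|a a0].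
    by rewrite !mxE !eqxx mul1r rmorph1 addr0 ler10.
  by rewrite !mxE (negbTE a0) mul0r.
exists tau^-1; first split.
- by rewrite invr_ge0 ltW.
- (* The rows of W are the basis vectors of the columns of H. *)
  pose W : 'M[C]_(1 + r, n) := rowsub h 1%:M.
  apply: (@spectral_diag_count _ _ _ _ W).
  + by rewrite realV gtr0_real.
  + apply/unitarymxP/matrixP => a b; rewrite !mxE (bigD1 (h a))//= big1 => [|k ka].
      by rewrite !mxE eqxx mul1r addr0 (inj_eq hI) eq_sym rmorph_nat.
    by rewrite !mxE eq_sym (negbTE ka) mul0r.
  + move=> y; rewrite mulrC ler_pdivrMr// mulrC.
    apply: le_trans (gram_lower_bound y uH) _.
    rewrite ler_pM2l//; apply: le_trans (quad_mask_le _ _ _) _.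
    have -> : colsub h A = A *m W^t*.
      apply/matrixP => a b; rewrite !mxE (bigD1 (h b))//= big1 => [|k kb].
        by rewrite !mxE eqxx rmorph1 mulr1 addr0.
      by rewrite !mxE eq_sym (negbTE kb) rmorph0 mulr0.
    by rewrite gramM trmxCK adjmx_mul !mulmxA.
- rewrite ler_pdivlMr// -(ler_pM2r Vgt0) !addn1 -subSn//.
  apply: le_trans tau_bnd.
  have -> : `|e i 0| ^+ 2 * (#|J|.+1 - r)%:R * tau * V =
    (#|J|.+1 - r)%:R * (`|e i 0| ^+ 2 * V * tau) by ring.
  by rewrite ler_wpM2l// ler_wpM2r// ltW.
Qed.

End Gram.

(** * Submatrices and the Moore-Penrose inverse *)
Section Submatrix.
Variable C : numClosedFieldType.

Lemma mask_colsub m n r (K : {set 'I_m}) (A : 'M[C]_(m, n)) (g : 'I_r -> 'I_n) :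
  mask_rows K (colsub g A) = colsub g (mask_rows K A).
Proof. by apply/matrixP => i j; rewrite !mxE. Qed.

Lemma mask_adjM m n p (K : {set 'I_m}) (A : 'M[C]_(m, n)) (B : 'M[C]_(m, p)) :
  (mask_rows K A)^t* *m B = (rows_mx A K)^t* *m rows_mx B K.
Proof.
apply/matrixP => a b; rewrite mxE [RHS]mxE.
under [RHS]eq_bigr do rewrite !mxE.
rewrite -(@big_enum_val _ _ _ _ (mem K) (fun k => (A k a)^* * B k b)) [RHS]big_mkcond.
apply: eq_bigr => k _; rewrite !mxE; case: ifP => // _.
by rewrite rmorph0 mul0r.
Qed.

Lemma gram_rows_mx m n (K : {set 'I_m}) (A : 'M[C]_(m, n)) :
  gram (rows_mx A K) = gram (mask_rows K A).
Proof.
rewrite /gram mask_adjM; congr (_ *m _).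
by apply/matrixP => a b; rewrite !mxE enum_valP.
Qed.

Lemma sub_mxE m n (A : 'M[C]_(m, n)) J K :
  sub_mx A J K = rows_mx (cols_mx A K) J.
Proof. by apply/matrixP => i j; rewrite !mxE. Qed.

(** A Gram determinant does not depend on the order in which the columns are
    listed; this lets the minors of a bordered matrix be compared with
    submatrices indexed by sets. *)
Lemma det_gram_sub_mx m n r (A : 'M[C]_(m, n)) (K : {set 'I_m})
    (h : 'I_r -> 'I_n) : injective h ->
  \det (gram (mask_rows K (colsub h A))) =
  \det (gram (sub_mx A K [set h a | a : 'I_r])).
Proof.
move=> hI; set L := [set _ | _ in _].
have hL a : h a \in L by apply/imsetP; exists a.
have cL : r = #|L| by rewrite card_imset// card_ord.
rewrite sub_mxE gram_rows_mx !mask_colsub !gram_colsub.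
have [a0 _|r0] := pickP (fun _ : 'I_r => true); last first.
  move: (gram _) => M; case: r h hI L hL cL r0 => [|r] h hI L hL cL r0; last first.
    by have := r0 ord0.
  rewrite det_mx00; move: (enum_val (A := _)); rewrite -cL => f.
  by rewrite det_mx00.
(* [p] is the permutation that sorts the columns listed by [h]. *)
pose p a := enum_rank_in (hL a0) (h a).
have pI : injective p.
  by move=> a b /(congr1 enum_val); rewrite !enum_rankK_in// => /hI.
rewrite -[RHS](det_mxsub_inj _ cL pI).
by congr (\det _); apply/matrixP => a b; rewrite !mxE !enum_rankK_in.
Qed.

Lemma moore_penrose_free m n (G : 'M[C]_(m, n)) :
  gram G \in unitmx -> moore_penrose G *m G = 1%:M.
Proof.
move=> uG; have /and4P[/eqP E _ _ _] := moore_penroseP G.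
rewrite -[LHS]mul1mx -(mulVmx uG) -mulmxA {2}/gram -!mulmxA (mulmxA G) E.
by rewrite mulVmx.
Qed.

Lemma adj_moore_penrose m n (G : 'M[C]_(m, n)) :
  G^t* *m (G *m moore_penrose G) = G^t*.
Proof.
have /and4P[/eqP E _ /eqP F _] := moore_penroseP G.
by rewrite -F -adjmx_mul E.
Qed.

End Submatrix.

(** * Singular values, volume, and the entrywise bound *)
Section SingularValues.
Variable R : realType.
Implicit Types m n : nat.

Lemma spectral_gramE m n (A : 'M[R[i]]_(m, n)) j :
  spectral_diag (gram A) 0 j = (complex.Re (spectral_diag (gram A) 0 j))%:C.
Proof. by rewrite RRe_real// ger0_real// spectral_gram_ge0. Qed.

Lemma Re_spectral_gram_ge0 m n (A : 'M[R[i]]_(m, n)) j :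
  0 <= complex.Re (spectral_diag (gram A) 0 j).
Proof. by rewrite -ler0c -spectral_gramE spectral_gram_ge0. Qed.

Lemma size_singular_values m n (A : 'M[R[i]]_(m, n)) :
  size (singular_values A) = n.
Proof. by rewrite size_sort size_map size_enum_ord. Qed.

Lemma singular_value_ge0 m n k (A : 'M[R[i]]_(m, n)) : 0 <= singular_value k A.
Proof.
rewrite /singular_value; have [ks|ks] := ltnP k.-1 n; last first.
  by rewrite nth_default// size_singular_values.
apply: (@all_nthP _ (>= 0) _ _ _) => //; last by rewrite size_singular_values.
rewrite all_sort all_map; apply/allP => j _ /=; exact: sqrtr_ge0.
Qed.

Lemma volume_ge0 m n (A : 'M[R[i]]_(m, n)) : 0 <= volume A.
Proof. by apply: prodr_ge0 => k _; exact: singular_value_ge0. Qed.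

Lemma volume_sqr m n (A : 'M[R[i]]_(m, n)) : (n <= m)%N ->
  (volume A ^+ 2)%:C = \det (gram A).
Proof.
move=> nm; rewrite /volume (minn_idPr nm) big_add1/=.
have -> : \prod_(0 <= k < n) singular_value k.+1 A =
    \prod_(x <- singular_values A) x.
  by rewrite [RHS](big_nth 0) size_singular_values.
rewrite /singular_values (perm_big _ (permEl (perm_sort _ _)))/=.
rewrite big_map big_enum/= -prodrXl rmorph_prod det_gram.
apply: eq_bigr => j _; rewrite sqr_sqrtr; last exact: Re_spectral_gram_ge0.
exact/esym/spectral_gramE.
Qed.

Lemma nth_sorted_ge (s : seq R) k (c : R) :
  sorted >=%R s -> (k < count (>= c)%R s)%N -> c <= s`_k.
Proof.
move=> ss ck; rewrite leNgt; apply/negP => sk.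
have ks : (k < size s)%N by rewrite (leq_trans ck)// count_size.
move: ck; rewrite -(cat_take_drop k s) count_cat.
rewrite [X in (_ + X)%N](_ : _ = 0%N) ?addn0; last first.
  apply/eqP; rewrite -leqn0 leqNgt -has_count -all_predC.
  apply/(all_nthP 0) => i; rewrite size_drop => ik /=.
  rewrite nth_drop -ltNge (le_lt_trans _ sk)//.
  apply: (sorted_leq_nth ge_trans ge_refl 0 ss).
  - by rewrite inE.
  - by rewrite inE -ltn_subRL.
  - exact: leq_addr.
by rewrite ltnNge (leq_trans (count_size _ _))// size_take ks.
Qed.

Lemma le_singular_value m n k (A : 'M[R[i]]_(m, n)) t : 0 <= t ->
  (k < #|[set j | (t <= spectral_diag (gram A) 0 j)%R]|)%N ->
  t <= (singular_value k.+1 A ^+ 2)%:C.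
Proof.
move=> t0; have /complex_realP[u tE] : t \is Num.real by exact: ger0_real.
rewrite tE in t0 *; rewrite ler0c in t0 => kc.
rewrite lecR -[u]sqr_sqrtr// ler_sqr ?nnegrE ?sqrtr_ge0 ?singular_value_ge0//.
apply: nth_sorted_ge.
  by apply: sort_sorted => x y; exact: le_total.
rewrite (leq_trans kc)// /singular_values count_sort count_map enumT.
rewrite cardE /enum_mem size_filter; apply: sub_count => j /=.
rewrite inE => h; apply: ler_wsqrtr.
by move: h; rewrite spectral_gramE lecR.
Qed.

(** In a column of K the residual is zero, because the pseudo-inverse of a matrix
    of full column rank is a left inverse.  In any other column j, the residual is
    that of the least-squares problem G x = A(J, j), so it is orthogonal to the
    columns of G on J, as [maxvol_residual] requires. *)
Lemma max_volume_entry_bound m n (A : 'M[R[i]]_(m, n)) (J : {set 'I_m})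
    (K : {set 'I_n}) (G := sub_mx A J K) :
  (#|K| <= #|J| < m)%N -> \rank G = #|K| ->
  (forall (J' : {set 'I_m}) (K' : {set 'I_n}), #|J'| = #|J| -> #|K'| = #|K| ->
     volume (sub_mx A J' K') <= volume G) ->
  forall i j,
  normc ((A - cols_mx A K *m moore_penrose G *m rows_mx A J) i j) <=
  Num.sqrt (1 + #|K|%:R) * Num.sqrt (1 + #|K|%:R / (#|J|%:R - #|K|%:R + 1)) *
  singular_value #|K|.+1 A.
Proof.
move=> /andP[KJ Jm] rG maxG i j; set s := singular_value _ _.
have uG : gram G \in unitmx.
  have := @gram_unit _ _ _ (G^t*); rewrite trmxCK; apply.
  by rewrite /row_free mxrank_map mxrank_tr rG.
pose g (b : 'I_#|K|) := enum_val b.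
have gI : injective g by exact: enum_val_inj.
have GE : gram (mask_rows J (colsub g A)) = gram G.
  by rewrite -gram_rows_mx /G sub_mxE.
pose x := moore_penrose G *m col j (rows_mx A J).
pose e := col j A - colsub g A *m x.
have -> : (A - cols_mx A K *m moore_penrose G *m rows_mx A J) i j = e i 0.
  rewrite /e /x mulmxA; move: (_ *m moore_penrose G) => Y.
  rewrite 2!mxE [RHS]mxE; congr (_ + _); first by rewrite mxE.
  rewrite [RHS]mxE; congr (- _); rewrite !mxE.
  by apply: eq_bigr => k _; rewrite !mxE.
have Ge : rows_mx (colsub g A) J *m x = G *m moore_penrose G *m col j (rows_mx A J).
  by rewrite /x -sub_mxE mulmxA.
have [jK|jK] := boolP (j \in K).
  have -> : e = 0.
    have xE : x = delta_mx (enum_rank_in jK j) 0.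
      rewrite /x; have -> : col j (rows_mx A J) = G *m delta_mx (enum_rank_in jK j) 0.
        by rewrite -colE; apply/matrixP => a b; rewrite !mxE enum_rankK_in.
      by rewrite mulmxA moore_penrose_free// mul1mx.
    rewrite /e xE -colE; apply/matrixP => a b.
    by rewrite !mxE /g enum_rankK_in// subrr.
  by rewrite mxE normc0 !mulr_ge0 ?sqrtr_ge0 ?singular_value_ge0.
have gj b : g b != j by apply: contra jK => /eqP <-; exact: enum_valP.
have V0 : \det (gram (mask_rows J (colsub g A))) != 0.
  by rewrite GE -unitfE -unitmxE.
have maxV (J' : {set 'I_m}) (h : 'I_#|K| -> 'I_n) : #|J'| = #|J| ->
    injective h -> \det (gram (mask_rows J' (colsub h A))) <=
    \det (gram (mask_rows J (colsub g A))).
  move=> cJ hI; set K' := [set h a | a : 'I_#|K|].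
  have cK : #|K'| = #|K| by rewrite card_imset// card_ord.
  rewrite det_gram_sub_mx// GE -!volume_sqr ?cJ ?cK// lecR.
  by rewrite ler_sqr ?maxG// nnegrE volume_ge0.
have orth : (mask_rows J (colsub g A))^t* *m e = 0.
  rewrite mask_adjM; have -> : rows_mx e J =
      col j (rows_mx A J) - rows_mx (colsub g A) J *m x.
    apply/matrixP => a b; rewrite !mxE; congr (_ - _).
    by apply: eq_bigr => k _; rewrite !mxE.
  by rewrite Ge -sub_mxE mulmxBr [_ *m (_ *m _ *m _)]mulmxA adj_moore_penrose subrr.
have KJm : (#|K| <= #|J| < m)%N by rewrite KJ.
have [t [t0 /(le_singular_value t0) ts] et] :=
  maxvol_residual i KJm gI gj V0 maxV orth.
have d0 : 0 < (#|J|%:R - #|K|%:R + 1 : R) by rewrite -natrB// ltr_wpDl.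
have {et} : normc (e i 0) ^+ 2 * (#|J|%:R - #|K|%:R + 1) <=
    (1 + #|K|%:R) * (#|J|%:R + 1) * s ^+ 2.
  rewrite -lecR.
  have -> : (normc (e i 0) ^+ 2 * (#|J|%:R - #|K|%:R + 1))%:C =
      `|e i 0| ^+ 2 * (#|J| - #|K| + 1)%:R.
    have -> : `|e i 0| = (normc (e i 0))%:C by rewrite normc_def; case: (e i 0).
    by rewrite natrD natrB// rmorphM rmorphXn rmorphD rmorphB !rmorph_nat.
  apply: (le_trans et).
  have -> : ((1 + #|K|%:R) * (#|J|%:R + 1) * s ^+ 2)%:C =
      (1 + #|K|)%:R * (#|J| + 1)%:R * (s ^+ 2)%:C.
    by rewrite !natrD !rmorphM !rmorphD !rmorph_nat.
  by rewrite ler_wpM2l// mulr_ge0.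
move=> H.
rewrite -[leLHS]ger0_norm; last by case: (e i 0) => a b; exact: sqrtr_ge0.
rewrite -sqrtr_sqr -[leRHS]ger0_norm; last first.
  by rewrite !mulr_ge0 ?sqrtr_ge0 ?singular_value_ge0.
rewrite -[leRHS]sqrtr_sqr ler_wsqrtr// !exprMn !sqr_sqrtr; last 2 first.
  by rewrite addr_ge0// divr_ge0// ltW.
  by rewrite addr_ge0.
rewrite -(ler_pM2r d0); apply: le_trans H _.
rewrite le_eqVlt; apply/orP; left; apply/eqP; field.
by rewrite gt_eqF.
Qed.

End SingularValues.

End LinearAlgebra.

Section Analysis.
Import numFieldNormedType.Exports.
Import ComplexField.Normc.
Import HBNNSimple.
Local Open Scope classical_set_scope.
Local Open Scope ring_scope.
Local Open Scope complex_scope.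
Local Notation "z ^*" := (Num.conj z) : complex_scope.

(** * Integration of complex-valued functions *)
Section ComplexIntegral.
Context d (T : measurableType d) (R : realType).
Variables (mu : {measure set T -> \bar R}) (D : set T) (mD : measurable D).
Implicit Types f g h : T -> R[i].

Lemma normc_sqr (z : R[i]) : normc z ^+ 2 = complex.Re z ^+ 2 + complex.Im z ^+ 2.
Proof. by case: z => a b; rewrite sqr_sqrtr// addr_ge0 ?sqr_ge0. Qed.

Lemma normc_nneg (z : R[i]) : 0 <= normc z.
Proof. by case: z => a b; exact: sqrtr_ge0. Qed.

Lemma mulc_conj (z : R[i]) : z * z^* = (normc z ^+ 2)%:C.
Proof.
rewrite normc_sqr; case: z => a b; apply/eqP; rewrite eq_complex/=.
by apply/andP; split; apply/eqP; ring.
Qed.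

Lemma normc_realc (u : R) : normc u%:C = `|u|.
Proof. by rewrite /= expr0n addr0 sqrtr_sqr. Qed.

Definition cmeasurable h := measurable_fun D (fun x => complex.Re (h x)) /\
  measurable_fun D (fun x => complex.Im (h x)).

Definition cintegrable h :=
  mu.-integrable D (EFin \o (fun x => complex.Re (h x))) /\
  mu.-integrable D (EFin \o (fun x => complex.Im (h x))).

Definition cintegral h : R[i] :=
  Rintegral mu D (fun x => complex.Re (h x)) +i*
  Rintegral mu D (fun x => complex.Im (h x)).

(** The squared norm is kept in the extended reals, so that it can be compared
    and split for functions known only to be measurable. *)
Definition enorm2 h : \bar R := (\int[mu]_(x in D) (normc (h x) ^+ 2)%:E)%E.

Definition square_integrable h := cmeasurable h /\ (enorm2 h < +oo)%E.

Lemma ReD (a b : R[i]) : complex.Re (a + b) = complex.Re a + complex.Re b.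
Proof. by case: a b => ? ? []. Qed.
Lemma ImD (a b : R[i]) : complex.Im (a + b) = complex.Im a + complex.Im b.
Proof. by case: a b => ? ? []. Qed.
Lemma ReN (a : R[i]) : complex.Re (- a) = - complex.Re a.
Proof. by case: a. Qed.
Lemma ImN (a : R[i]) : complex.Im (- a) = - complex.Im a.
Proof. by case: a. Qed.
Lemma ReM (a b : R[i]) : complex.Re (a * b) =
  complex.Re a * complex.Re b - complex.Im a * complex.Im b.
Proof. by case: a b => ? ? []. Qed.
Lemma ImM (a b : R[i]) : complex.Im (a * b) =
  complex.Re a * complex.Im b + complex.Im a * complex.Re b.
Proof. by case: a b => ? ? []. Qed.
Lemma ReJ (a : R[i]) : complex.Re a^* = complex.Re a.
Proof. by case: a. Qed.
Lemma ImJ (a : R[i]) : complex.Im a^* = - complex.Im a.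
Proof. by case: a. Qed.

Lemma cmeasurable_cst c : cmeasurable (fun _ => c).
Proof. by split; exact: measurable_cst. Qed.

Lemma cmeasurable_real (u : T -> R) : measurable_fun D u ->
  cmeasurable (fun x => (u x)%:C).
Proof. by move=> mu_; split => //=; exact: measurable_cst. Qed.

Lemma cmeasurableD f g : cmeasurable f -> cmeasurable g ->
  cmeasurable (fun x => f x + g x).
Proof.
move=> [f1 f2] [g1 g2]; split; under eq_fun do rewrite ?ReD ?ImD.
  exact: measurable_funD. exact: measurable_funD.
Qed.

Lemma cmeasurableN f : cmeasurable f -> cmeasurable (fun x => - f x).
Proof.
move=> [f1 f2]; split; under eq_fun do rewrite ?ReN ?ImN.
  exact: measurable_funN. exact: measurable_funN.
Qed.

Lemma cmeasurableB f g : cmeasurable f -> cmeasurable g ->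
  cmeasurable (fun x => f x - g x).
Proof. by move=> mf mg; apply: cmeasurableD => //; exact: cmeasurableN. Qed.

Lemma cmeasurableM f g : cmeasurable f -> cmeasurable g ->
  cmeasurable (fun x => f x * g x).
Proof.
move=> [f1 f2] [g1 g2]; split; under eq_fun do rewrite ?ReM ?ImM.
  by apply: measurable_funB; exact: measurable_funM.
by apply: measurable_funD; exact: measurable_funM.
Qed.

Lemma cmeasurableJ f : cmeasurable f -> cmeasurable (fun x => (f x)^*).
Proof.
move=> [f1 f2]; split; under eq_fun do rewrite ?ReJ ?ImJ.
  exact: f1.
exact: measurable_funN.
Qed.

Lemma cmeasurable_sum I (s : seq I) (F : I -> T -> R[i]) :
  (forall i, cmeasurable (F i)) -> cmeasurable (fun x => \sum_(i <- s) F i x).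
Proof.
move=> mF; elim: s => [|i s IH].
  under eq_fun do rewrite big_nil; exact: cmeasurable_cst.
under eq_fun do rewrite big_cons; exact: cmeasurableD.
Qed.

Lemma measurable_normc2 f : cmeasurable f ->
  measurable_fun D (fun x => normc (f x) ^+ 2).
Proof.
move=> [f1 f2]; under eq_fun do rewrite normc_sqr.
by apply: measurable_funD; exact: measurable_funX.
Qed.

Lemma cintegrableD f g : cintegrable f -> cintegrable g ->
  cintegrable (fun x => f x + g x).
Proof.
move=> [f1 f2] [g1 g2]; split.
  apply: eq_integrable (integrableD mD f1 g1) => // x _ /=.
  by rewrite ReD EFinD.
apply: eq_integrable (integrableD mD f2 g2) => // x _ /=.
by rewrite ImD EFinD.
Qed.

Lemma cintegrableZ c f : cintegrable f -> cintegrable (fun x => c * f x).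
Proof.
move=> [f1 f2]; split.
  have := integrableB mD (integrableZl mD (complex.Re c) f1)
                         (integrableZl mD (complex.Im c) f2).
  by apply: eq_integrable => // x _ /=; rewrite ReM EFinB !EFinM.
have := integrableD mD (integrableZl mD (complex.Re c) f2)
                       (integrableZl mD (complex.Im c) f1).
by apply: eq_integrable => // x _ /=; rewrite ImM EFinD !EFinM.
Qed.

Lemma cintegrable0 : cintegrable (fun=> 0).
Proof. by split; exact: integrable0. Qed.

Lemma cintegrable_sum I (s : seq I) (F : I -> T -> R[i]) :
  (forall i, cintegrable (F i)) -> cintegrable (fun x => \sum_(i <- s) F i x).
Proof.
move=> mF; elim: s => [|i s IH].
  under eq_fun do rewrite big_nil; exact: cintegrable0.
under eq_fun do rewrite big_cons; exact: cintegrableD.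
Qed.

Lemma cintegralD f g : cintegrable f -> cintegrable g ->
  cintegral (fun x => f x + g x) = cintegral f + cintegral g.
Proof.
move=> [f1 f2] [g1 g2]; rewrite /cintegral.
under eq_Rintegral do rewrite ReD.
under [X in _ +i* X]eq_Rintegral do rewrite ImD.
by rewrite !RintegralD.
Qed.

Lemma cintegralZ c f : cintegrable f ->
  cintegral (fun x => c * f x) = c * cintegral f.
Proof.
move=> [f1 f2]; rewrite /cintegral.
under eq_Rintegral do rewrite ReM.
under [X in _ +i* X]eq_Rintegral do rewrite ImM.
have Z (k : R) (u : T -> R) : mu.-integrable D (EFin \o u) ->
    mu.-integrable D (EFin \o (fun x => k * u x)).
  by move=> iu; apply: eq_integrable (integrableZl mD k iu).
rewrite RintegralB ?RintegralD ?RintegralZl//; try exact: Z.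
by case: c.
Qed.

Lemma cintegral0 : cintegral (fun=> 0) = 0.
Proof. by rewrite /cintegral /= !Rintegral_cst// !mul0r. Qed.

Lemma cintegral_sum I (s : seq I) (F : I -> T -> R[i]) :
  (forall i, cintegrable (F i)) ->
  cintegral (fun x => \sum_(i <- s) F i x) = \sum_(i <- s) cintegral (F i).
Proof.
move=> mF; elim: s => [|i s IH].
  under eq_fun do rewrite big_nil; by rewrite big_nil cintegral0.
under eq_fun do rewrite big_cons.
by rewrite cintegralD// ?IH ?big_cons//; exact: cintegrable_sum.
Qed.

Lemma cintegralJ f : cintegrable f ->
  cintegral (fun x => (f x)^*) = (cintegral f)^*.
Proof.
move=> [f1 f2]; rewrite /cintegral.
under eq_Rintegral do rewrite ReJ.
under [X in _ +i* X]eq_Rintegral do rewrite ImJ -mulN1r.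
by rewrite RintegralZl// mulN1r.
Qed.

Lemma square_integrable_normc2 f : square_integrable f ->
  mu.-integrable D (EFin \o (fun x => normc (f x) ^+ 2)).
Proof.
move=> [mf ff]; apply/integrableP; split.
  by apply/measurable_EFinP; exact: measurable_normc2.
rewrite (eq_integral (fun x => (normc (f x) ^+ 2)%:E))// => x _.
by rewrite /= ger0_norm ?sqr_ge0.
Qed.

(** Products of coordinates are at most the sum of the squares. *)
Lemma cintegrable_mulJ f g : square_integrable f -> square_integrable g ->
  cintegrable (fun x => f x * (g x)^*).
Proof.
move=> sf sg; have [mf _] := sf; have [mg _] := sg.
have H := integrableD mD (square_integrable_normc2 sf) (square_integrable_normc2 sg).
have [m1 m2] := cmeasurableM mf (cmeasurableJ mg).
have B (a b c e : R) : `|a * c + b * e| <= a ^+ 2 + b ^+ 2 + (c ^+ 2 + e ^+ 2).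
  have := (sqr_ge0 (a - c), sqr_ge0 (a + c), sqr_ge0 (b - e), sqr_ge0 (b + e)).
  have := (sqr_ge0 a, sqr_ge0 b, sqr_ge0 c, sqr_ge0 e).
  move=> [[[h1 h2] h3] h4] [[[h5 h6] h7] h8].
  by rewrite ler_norml; apply/andP; split; nra.
split; apply: le_integrable H => //.
- exact/measurable_EFinP.
- move=> x _ /=; rewrite lee_fin !normc_sqr ReM ReJ ImJ mulrN opprK.
  by rewrite [leRHS]ger0_norm// !addr_ge0 ?sqr_ge0.
- exact/measurable_EFinP.
- move=> x _ /=; rewrite lee_fin !normc_sqr ImM ReJ ImJ addrC.
  rewrite [leRHS]ger0_norm ?addr_ge0 ?sqr_ge0//.
  apply: le_trans (B _ _ _ _) _.
  rewrite sqrrN; lra.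
Qed.

Lemma cintegral_normc2 f :
  cintegral (fun x => f x * (f x)^*) =
  (Rintegral mu D (fun x => normc (f x) ^+ 2))%:C.
Proof.
rewrite /cintegral; under eq_Rintegral do rewrite mulc_conj.
under [X in _ +i* X]eq_Rintegral do rewrite mulc_conj.
by rewrite Rintegral_cst// mul0r.
Qed.

Lemma enorm2D f g : cmeasurable f -> cmeasurable g ->
  (enorm2 (fun x => (f x + g x)%R) <= 2%:E * enorm2 f + 2%:E * enorm2 g)%E.
Proof.
move=> mf mg; rewrite /enorm2.
have n0 h x : (0 <= (normc (h x) ^+ 2)%:E)%E by rewrite lee_fin sqr_ge0.
have mn h : cmeasurable h -> measurable_fun D (fun x => (normc (h x) ^+ 2)%:E).
  by move=> mh; apply/measurable_EFinP; exact: measurable_normc2.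
rewrite -!ge0_integralZl_EFin//; try exact: mn.
rewrite -ge0_integralD//; first last.
- by apply: measurable_funeM; exact: mn.
- by move=> x _; rewrite mule_ge0.
- by apply: measurable_funeM; exact: mn.
- by move=> x _; rewrite mule_ge0.
apply: ge0_le_integral => //.
- by move=> x _; rewrite lee_fin sqr_ge0.
- exact/(mn (fun x => f x + g x))/cmeasurableD.
- by apply: emeasurable_funD; apply: measurable_funeM; exact: mn.
- move=> x _; rewrite -!EFinM -EFinD lee_fin !normc_sqr ReD ImD.
  have := sqr_ge0 (complex.Re (f x) - complex.Re (g x)).
  have := sqr_ge0 (complex.Im (f x) - complex.Im (g x)).
  by nra.
Qed.

Lemma le_enorm2 f g : cmeasurable f -> cmeasurable g ->
  (forall x, D x -> normc (f x) <= normc (g x)) -> (enorm2 f <= enorm2 g)%E.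
Proof.
move=> mf mg fg; apply: ge0_le_integral => //.
- by move=> x _; rewrite lee_fin sqr_ge0.
- by apply/measurable_EFinP; exact: measurable_normc2.
- by apply/measurable_EFinP; exact: measurable_normc2.
- by move=> x Dx; rewrite lee_fin ler_sqr ?nnegrE ?normc_nneg// fg.
Qed.

Lemma enorm2Z (k : R) f : cmeasurable f ->
  enorm2 (fun x => k%:C * f x) = ((k ^+ 2)%:E * enorm2 f)%E.
Proof.
move=> mf; rewrite /enorm2 -ge0_integralZl_EFin ?sqr_ge0//.
- by apply: eq_integral => x _; rewrite normcM normc_realc exprMn real_normK ?num_real.
- by move=> x _; rewrite lee_fin sqr_ge0.
- by apply/measurable_EFinP; exact: measurable_normc2.
Qed.

End ComplexIntegral.

(** * Polynomials converging to a step *)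
Section StepPolynomial.
Variable R : realType.
Implicit Types (a w u : R) (n : nat).

Lemma bernoulli_ge a n : 0 <= a -> 1 + n%:R * a <= (1 + a) ^+ n.
Proof.
move=> a0; elim: n => [|n IH]; first by rewrite mul0r addr0 expr0.
rewrite exprS; apply: (@le_trans _ _ ((1 + a) * (1 + n%:R * a))).
  rewrite -natr1; have : 0 <= n%:R * a * a by rewrite !mulr_ge0.
  by nra.
by rewrite ler_wpM2l// addr_ge0.
Qed.

Lemma bernoulli_le a n : 0 <= a <= 1 -> 1 - n%:R * a <= (1 - a) ^+ n.
Proof.
move=> /andP[a0 a1]; elim: n => [|n IH]; first by rewrite mul0r subr0 expr0.
rewrite exprS; apply: (@le_trans _ _ ((1 - a) * (1 - n%:R * a))).
  rewrite -natr1; have : 0 <= n%:R * a * a by rewrite !mulr_ge0.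
  by nra.
by rewrite ler_wpM2l// subr_ge0.
Qed.

Lemma onem_expr_le a n : 0 <= a <= 1 -> (1 - a) ^+ n <= (1 + n%:R * a)^-1.
Proof.
move=> /andP[a0 a1]; have p : 0 < 1 + n%:R * a by rewrite ltr_wpDr// mulr_ge0.
rewrite -[leRHS]mul1r ler_pdivlMr//.
apply: (@le_trans _ _ ((1 - a) ^+ n * (1 + a) ^+ n)).
  by rewrite ler_wpM2l ?exprn_ge0 ?subr_ge0// bernoulli_ge.
rewrite -exprMn; apply: exprn_ile1; nra.
Qed.

(** With s the square root of w and h = 1 / s - 1, Bernoulli's inequality gives
    n s^n <= 1 / h, hence n w^n <= s^n / h. *)
Lemma cvg_natr_expr w : 0 <= w < 1 -> (n%:R * w ^+ n) @[n --> \oo] --> (0 : R).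
Proof.
move=> /andP[]; rewrite le_eqVlt => /predU1P[<- _|w0 w1].
  apply: cvg_near_cst; near=> n; rewrite expr0n gt_eqF ?mulr0//.
  by near: n; exists 1%N.
pose s := Num.sqrt w; have s0 : 0 < s by rewrite sqrtr_gt0.
have s1 : s < 1 by rewrite -sqrtr1 ltr_sqrt.
pose h := s^-1 - 1; have h0 : 0 < h by rewrite subr_gt0 invf_gt1.
apply: (@squeeze_cvgr _ _ _ _ (cst 0) (fun n => h^-1 * s ^+ n)).
- near=> n; rewrite mulr_ge0 ?exprn_ge0 ?(ltW w0)//=.
  rewrite -[w]sqr_sqrtr ?(ltW w0)// -/s -exprM mulnC exprM expr2 mulrA.
  rewrite ler_wpM2r ?exprn_ge0 ?(ltW s0)//.
  rewrite -[leRHS]mul1r ler_pdivlMr// mulrAC.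
  have := bernoulli_ge n (ltW h0); rewrite [1 + h]addrC subrK exprVn.
  rewrite -[leRHS]mul1r ler_pdivlMr ?exprn_gt0// => H.
  apply: le_trans H; rewrite ler_wpM2r ?exprn_ge0 ?(ltW s0)//.
  by rewrite ler_wpDl.
- exact: cvg_cst.
- rewrite -(mulr0 h^-1); apply: cvgMr.
  by apply: cvg_expr; rewrite ger0_norm ?ltW.
Unshelve. all: by end_near. Qed.

(** The exponent is n * 2 ^ n rather than 2 ^ n so that the limit is 0, not
    1 / e, at the threshold u = 1 / 2. *)
Definition step_poly n u := (1 - u ^+ n) ^+ (n * 2 ^ n).

Lemma step_poly_itv n u : 0 <= u <= 1 -> 0 <= step_poly n u <= 1.
Proof.
move=> /andP[u0 u1]; have p1 : u ^+ n <= 1 by exact: exprn_ile1.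
have p0 : 0 <= u ^+ n by exact: exprn_ge0.
by rewrite exprn_ge0 ?subr_ge0//= exprn_ile1 ?subr_ge0// gerBl.
Qed.

(** Compare n 2^n u^n = n (2 u)^n with 0 or infinity.  Below 1/2, Bernoulli's
    inequality gives 1 - n (2 u)^n as a lower bound; from 1/2 on, it gives
    1 / (1 + n) as an upper bound. *)
Lemma cvg_step_poly u : 0 <= u <= 1 ->
  step_poly n u @[n --> \oo] --> ((u < 2^-1)%R%:R : R).
Proof.
move=> u01; have /andP[u0 u1] := u01.
have p01 n : 0 <= u ^+ n <= 1 by rewrite exprn_ge0// exprn_ile1.
have [ul|ul] := ltP u 2^-1.
  apply: (@squeeze_cvgr _ _ _ _ (fun n => 1 - n%:R * (2 * u) ^+ n) (cst 1)).
  - near=> n; have /andP[_ ->] := step_poly_itv n u01; rewrite andbT.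
    by have := bernoulli_le (n * 2 ^ n) (p01 n); rewrite exprMn natrM natrX mulrA.
  - rewrite -[X in _ --> X]subr0; apply: cvgB; first exact: cvg_cst.
    by apply: cvg_natr_expr; rewrite mulr_ge0//= mulrC -ltr_pdivlMr// mul1r.
  - exact: cvg_cst.
apply: (@squeeze_cvgr _ _ _ _ (cst 0) harmonic).
- near=> n; have /andP[-> _] := step_poly_itv n u01; rewrite /=.
  apply: le_trans (onem_expr_le _ (p01 n)) _.
  rewrite lef_pV2 ?posrE//; last by rewrite ltr_wpDr// mulr_ge0//; case/andP: (p01 n).
  rewrite -natr1 addrC lerD2l natrM natrX -mulrA -exprMn ler_peMr//.
  by rewrite exprn_ege1// -ler_pdivrMl// mulr1.
- exact: cvg_cst.
- exact: cvg_harmonic.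
Unshelve. all: by end_near. Qed.

End StepPolynomial.

(** * The L^2 closure of an algebra of bounded functions *)
Record bounded_algebra d (T : measurableType d) (R : realType) (D : set T)
    (P : set (T -> R[i])) : Prop := BoundedAlgebra {
  ba_cst : forall c, P (fun=> c);
  ba_add : forall p q, P p -> P q -> P (fun x => p x + q x);
  ba_mul : forall p q, P p -> P q -> P (fun x => p x * q x);
  ba_meas : forall p, P p -> cmeasurable D p;
  ba_bounded : forall p, P p -> exists K, forall x, D x -> normc (p x) <= K }.

Section Closure.
Context d (T : measurableType d) (R : realType).
Variables (mu : {measure set T -> \bar R}) (D : set T) (mD : measurable D).
Hypothesis muD : (mu D < +oo)%E.
Variable P : set (T -> R[i]).
Hypothesis PA : bounded_algebra D P.
Let P_cst := ba_cst PA.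
Let P_add := ba_add PA.
Let P_mul := ba_mul PA.
Let P_meas := ba_meas PA.
Let P_bounded := ba_bounded PA.
Implicit Types f g : T -> R[i].

Definition approximable g := cmeasurable D g /\
  forall e : R, 0 < e ->
    exists2 p, P p & (enorm2 mu D (fun x => (p x - g x)%R) < e%:E)%E.

Lemma approximable_mem p : P p -> approximable p.
Proof.
move=> Pp; split; first exact: P_meas.
move=> e e0; exists p => //; rewrite /enorm2.
under eq_integral do rewrite subrr normc0 expr0n.
by rewrite integral0 lte_fin.
Qed.

Lemma enorm2_lt_split f g (e : R) : cmeasurable D f -> cmeasurable D g -> 0 < e ->
  (enorm2 mu D f < (e / 4)%:E)%E -> (enorm2 mu D g < (e / 4)%:E)%E ->
  (enorm2 mu D (fun x => (f x + g x)%R) < e%:E)%E.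
Proof.
move=> mf mg e0 fe ge; apply: (le_lt_trans (enorm2D mu mD mf mg)).
have -> : e%:E = (2%:E * (e / 4)%:E + 2%:E * (e / 4)%:E)%E.
  by rewrite -EFinM -EFinD; congr EFin; field.
by rewrite lteD// lte_pmul2l.
Qed.

Lemma approximableD f g : approximable f -> approximable g ->
  approximable (fun x => f x + g x).
Proof.
move=> [mf af] [mg ag]; split; first exact: cmeasurableD.
move=> e e0; have e4 : 0 < e / 4 by rewrite divr_gt0.
have [p Pp pf] := af _ e4; have [q Pq qg] := ag _ e4.
exists (fun x => p x + q x); first exact: P_add.
have -> : (fun x => p x + q x - (f x + g x)) =
    (fun x => (p x - f x) + (q x - g x)).
  by apply/funext => x; rewrite opprD addrACA.
by apply: enorm2_lt_split => //; apply: cmeasurableB => //; exact: P_meas.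
Qed.

Definition cbounded f := exists2 K : R, 0 < K & forall x, D x -> normc (f x) <= K.

Lemma cbounded_mem p : P p -> cbounded p.
Proof.
move=> /P_bounded[K pK]; exists (`|K| + 1); first by rewrite ltr_wpDl.
by move=> x /pK /le_trans; apply; rewrite ler_wpDr// ler_norm.
Qed.

Lemma enorm2M_lt f g K (e : R) : cmeasurable D f -> cmeasurable D g -> 0 < K ->
  (forall x, D x -> normc (f x) <= K) -> (enorm2 mu D g < (e / K ^+ 2)%:E)%E ->
  (enorm2 mu D (fun x => (f x * g x)%R) < e%:E)%E.
Proof.
move=> mf mg K0 fK ge.
apply: (@le_lt_trans _ _ (enorm2 mu D (fun x => (K%:C * g x)%R))).
  apply: le_enorm2 => //.
  - exact: cmeasurableM.
  - by apply: cmeasurableM => //; exact: cmeasurable_cst.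
  - move=> x Dx; rewrite !normcM normc_realc ger0_norm ?(ltW K0)//.
    by rewrite ler_wpM2r ?normc_nneg// fK.
rewrite enorm2Z//.
have -> : e%:E = ((K ^+ 2)%:E * (e / K ^+ 2)%:E)%E.
  by rewrite -EFinM mulrC divfK// gt_eqF// exprn_gt0.
by rewrite lte_pmul2l// lte_fin exprn_gt0.
Qed.

(** The factor g is approximated first, by q: how well f must be approximated
    depends on a bound for q. *)
Lemma approximableM f g : cbounded f -> approximable f -> approximable g ->
  approximable (fun x => f x * g x).
Proof.
move=> [K K0 fK] [mf af] [mg ag]; split; first exact: cmeasurableM.
move=> e e0; have e4 : 0 < e / 4 by rewrite divr_gt0.
have [|q Pq qg] := ag (e / 4 / K ^+ 2); first by rewrite divr_gt0// exprn_gt0.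
have [L L0 qL] := cbounded_mem Pq.
have [|p Pp pf] := af (e / 4 / L ^+ 2); first by rewrite divr_gt0// exprn_gt0.
exists (fun x => p x * q x); first exact: P_mul.
have -> : (fun x => p x * q x - f x * g x) =
    (fun x => q x * (p x - f x) + f x * (q x - g x)).
  by apply/funext => x; ring.
have mp := P_meas Pp; have mq := P_meas Pq.
apply: enorm2_lt_split => //.
- by apply: cmeasurableM => //; exact: cmeasurableB.
- by apply: cmeasurableM => //; exact: cmeasurableB.
- by apply: enorm2M_lt qL _ => //; exact: cmeasurableB.
- by apply: enorm2M_lt fK _ => //; exact: cmeasurableB.
Qed.

Lemma approximable_cst c : approximable (fun=> c).
Proof. exact/approximable_mem/P_cst. Qed.

(** Dominated convergence makes the distance from G n to g tend to zero. *)
Lemma approximable_lim (G : nat -> T -> R[i]) g (h : T -> R) :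
  (forall n, approximable (G n)) -> cmeasurable D g ->
  mu.-integrable D (EFin \o h) ->
  (forall n x, D x -> normc (G n x - g x) ^+ 2 <= h x) ->
  (forall x, D x -> normc (G n x - g x) @[n --> \oo] --> 0) ->
  approximable g.
Proof.
move=> aG mg ih Gh Gg; split => // e e0.
have e4 : 0 < e / 4 by rewrite divr_gt0.
have mGg n : cmeasurable D (fun x => G n x - g x).
  by apply: cmeasurableB => //; have [] := aG n.
have : enorm2 mu D (fun x => G n x - g x) @[n --> \oo] --> 0%E.
  rewrite -(integral0 mu D).
  apply: (@dominated_cvg _ _ _ mu D mD _ _ (EFin \o h)) => //.
  - by move=> n; apply/measurable_EFinP; exact: measurable_normc2.
  - move=> x Dx; apply: cvg_EFin; first by near=> n.
    rewrite [X in _ --> X](_ : _ = 0 * 0); last by rewrite mulr0.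
    by under eq_cvg do rewrite /= expr2; apply: cvgM; exact: Gg.
  - by move=> n x Dx; rewrite /= lee_fin ger0_norm ?sqr_ge0// Gh.
move=> /(_ [set x | x < (e / 4)%:E]%E)[].
  by apply: open_nbhs_nbhs; split; [exact: open_ereal_lt_ereal|rewrite /= lte_fin].
move=> n _ /(_ n (leqnn n)) /= Gn.
have [_ /(_ _ e4)[p Pp pG]] := aG n.
exists p => //; have -> : (fun x => p x - g x) =
    (fun x => (p x - G n x) + (G n x - g x)).
  by apply/funext => x; rewrite addrA subrK.
apply: enorm2_lt_split => //.
by apply: cmeasurableB; [exact: P_meas|have [] := aG n].
Unshelve. all: by end_near. Qed.

Definition approximable_set (E : set T) := measurable E /\
  approximable (fun x => (\1_E x)%:C).

Lemma cbounded_indic E : cbounded (fun x => (\1_E x)%:C).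
Proof.
exists 1 => // x _; rewrite normc_realc indicE.
by case: (x \in E); rewrite ?normr1 ?normr0.
Qed.

Lemma approximable_setC E : approximable_set E -> approximable_set (~` E).
Proof.
move=> [mE aE]; split; first exact: measurableC.
have -> : (fun x => (\1_(~` E) x)%:C) = (fun x => 1 + (-1) * (\1_E x)%:C) :> (T -> R[i]).
  apply/funext => x; rewrite !indicE in_setC.
  by case: (x \in E); rewrite /= ?rmorph1 ?rmorph0 ?mulr1 ?mulr0 ?addr0 ?subrr.
apply: approximableD; first exact: approximable_cst.
apply: approximableM => //; last exact: approximable_cst.
by apply/cbounded_mem/P_cst.
Qed.

Lemma approximable_setI E F : approximable_set E -> approximable_set F ->
  approximable_set (E `&` F).
Proof.
move=> [mE aE] [mF aF]; split; first exact: measurableI.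
have -> : (fun x => (\1_(E `&` F) x)%:C) =
    (fun x => (\1_E x)%:C * (\1_F x)%:C) :> (T -> R[i]).
  apply/funext => x; rewrite !indicE in_setI.
  by case: (x \in E); case: (x \in F); rewrite /= ?rmorph1 ?rmorph0 ?mulr1 ?mulr0.
by apply: approximableM => //; exact: cbounded_indic.
Qed.

Lemma approximable_setU E F : approximable_set E -> approximable_set F ->
  approximable_set (E `|` F).
Proof.
move=> aE aF; rewrite -[E `|` F]setCK setCU.
by apply: approximable_setC; apply: approximable_setI; exact: approximable_setC.
Qed.

Lemma approximable_set0 : approximable_set set0.
Proof.
split => //; have -> : (fun x => (\1_set0 x)%:C) = (fun=> 0) :> (T -> R[i]).
  by apply/funext => x; rewrite indic0.
exact: approximable_cst.
Qed.

Lemma integrable_cst1 : mu.-integrable D (EFin \o cst (1 : R)).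
Proof.
apply: measurable_bounded_integrable => //; exists 1; split; first exact: num_real.
by move=> M M1 x _ /=; rewrite normr1 ltW.
Qed.

Lemma approximable_bigcup (F : (set T)^nat) :
  (forall n, approximable_set (F n)) -> approximable_set (\bigcup_n F n).
Proof.
move=> aF; have mF n : measurable (F n) by have [] := aF n.
have mU : measurable (\bigcup_n F n) by exact: bigcup_measurable.
split => //; pose U n := \big[setU/set0]_(i < n) F i.
have aU n : approximable_set (U n).
  rewrite /U; elim: n => [|n IH]; first by rewrite big_ord0; exact: approximable_set0.
  by rewrite big_ord_recr/=; exact: approximable_setU.
apply: (@approximable_lim (fun n x => (\1_(U n) x)%:C) _ (cst 1)).
- by move=> n; have [] := aU n.
- by apply: cmeasurable_real; exact: measurable_indic.
- exact: integrable_cst1.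
- move=> n x _; rewrite -rmorphB normc_realc !indicE.
  by case: (_ \in _); case: (_ \in _);
    rewrite /= ?subrr ?subr0 ?sub0r ?normrN ?normr1 ?normr0 ?expr1n ?expr0n.
- move=> x _; apply: cvg_near_cst.
  have [[m _ Fmx]|nF] := pselect ((\bigcup_n F n) x).
    near=> n; rewrite !indicE !mem_set ?subrr ?normc0//; first by exists m.
    by apply: bigsetU_sup Fmx; near: n; exists m.+1.
  near=> n; rewrite !indicE !memNset ?subrr ?normc0//.
  by move=> Ux; apply: nF; exact: (bigsetU_bigcup Ux).
Unshelve. all: by end_near. Qed.

(** Complements and intersections come from the algebra operations on indicators,
    countable unions from dominated convergence. *)
Lemma sigma_algebra_approximable : sigma_algebra setT approximable_set.
Proof.
split; first exact: approximable_set0.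
- by move=> E aE; rewrite setTD; exact: approximable_setC.
- exact: approximable_bigcup.
Qed.

Lemma approximableX f n : cbounded f -> approximable f ->
  approximable (fun x => f x ^+ n) /\ cbounded (fun x => f x ^+ n).
Proof.
move=> [K K0 fK] af; elim: n => [|n [IH [L L0 fL]]].
  by split; [exact: approximable_cst | apply/cbounded_mem/P_cst].
split.
  under eq_fun do rewrite exprS.
  by apply: approximableM => //; exists K.
exists (K * L); first exact: mulr_gt0.
by move=> x Dx; rewrite exprS normcM ler_pM ?normc_nneg// ?fK ?fL.
Qed.

Lemma approximable_level (u : T -> R) : measurable_fun setT u ->
  approximable (fun x => (u x)%:C) -> (forall x, 0 <= u x <= 1) ->
  approximable_set [set x | u x < 2^-1].
Proof.
move=> mu_ au u01; have mE : measurable [set x | u x < 2^-1].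
  rewrite -[X in measurable X]setTI.
  exact: (mu_ measurableT [set r | r < 2^-1] (measurable_itv `]-oo, 2^-1[)).
split => //.
have bu : cbounded (fun x => (u x)%:C).
  exists 1 => // x _; rewrite normc_realc; have /andP[u0 u1] := u01 x.
  by rewrite ger0_norm.
have as_ n : approximable (fun x => (step_poly n (u x))%:C).
  have [aX bX] := approximableX n bu au.
  have -> : (fun x => (step_poly n (u x))%:C) =
      (fun x => (1 + (-1) * (u x)%:C ^+ n) ^+ (n * 2 ^ n)).
    by apply/funext => x; rewrite mulN1r rmorphXn rmorphB rmorphXn.
  apply: (proj1 (@approximableX (fun x => 1 + (-1) * (u x)%:C ^+ n) _ _ _)).
    exists 1 => // x _; rewrite mulN1r -rmorphXn.
    rewrite -(rmorphB (real_complex R) 1) normc_realc.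
    have /andP[u0 u1] := u01 x; rewrite ger0_norm ?subr_ge0 ?exprn_ile1//.
    by rewrite gerBl exprn_ge0.
  apply: approximableD; first exact: approximable_cst.
  apply: approximableM => //; last exact: approximable_cst.
  exact/cbounded_mem/P_cst.
have iE x : \1_[set x | u x < 2^-1] x = (u x < 2^-1)%R%:R :> R.
  rewrite indicE; congr (_%:R); congr nat_of_bool.
  by apply/idP/idP => [/set_mem//|?]; exact/mem_set.
apply: (@approximable_lim (fun n x => (step_poly n (u x))%:C) _ (cst 1)) => //.
- by apply: cmeasurable_real; exact: measurable_indic.
- exact: integrable_cst1.
- move=> n x _; rewrite -rmorphB normc_realc iE real_normK ?num_real//.
  have /andP[] := step_poly_itv n (u01 x).
  by case: (_ < _); rewrite /= => ? ?; nra.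
- move=> x _; rewrite (_ : (fun n => _) =
      (fun n => `|step_poly n (u x) - (u x < 2^-1)%R%:R|)); last first.
    by apply/funext => n; rewrite -rmorphB normc_realc iE.
  apply/norm_cvg0P.
  rewrite -(subrr ((u x < 2^-1)%R%:R : R)).
  by apply: cvgB; [exact: cvg_step_poly|exact: cvg_cst].
Qed.

(** An affine change of scale moves the level c to 1/2 and the range of u into
    [0, 1]. *)
Lemma approximable_lt (u : T -> R) K c : measurable_fun setT u ->
  approximable (fun x => (u x)%:C) -> (forall x, `|u x| <= K) ->
  approximable_set [set x | u x < c].
Proof.
move=> mu_ au uK.
(* Over an empty domain K might be negative. *)
have [t0|T0] := pselect (exists t : T, True); last first.
  have -> : [set x | u x < c] = set0.
    by apply/seteqP; split => x // _; case: T0; exists x.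
  exact: approximable_set0.
have K0 : 0 <= K by case: t0 => t _; apply: le_trans (uK t).
pose L := K + `|c| + 1; have L0 : 0 < L by rewrite ltr_wpDl// addr_ge0.
pose b := (2 * L)^-1; have b0 : 0 < b by rewrite invr_gt0 mulr_gt0.
have -> : [set x | u x < c] = [set x | (2^-1 - b * c) + b * u x < 2^-1].
  apply/seteqP; split => x /=;
    rewrite addrAC -addrA -mulrBr gtrDl pmulr_rlt0// subr_lt0//.
apply: approximable_level.
- apply: measurable_funD => //; apply: measurable_funM => //; exact: measurable_cst.
- have -> : (fun x => (2^-1 - b * c + b * u x)%:C) =
     (fun x => (2^-1 - b * c)%:C + b%:C * (u x)%:C).
    by apply/funext => x; rewrite rmorphD rmorphM.
  apply: approximableD; first exact: approximable_cst.
  apply: approximableM => //; last exact: approximable_cst.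
  exact/cbounded_mem/P_cst.
- move=> x; have : `|u x - c| <= L.
    apply: (le_trans (ler_normB _ _)); rewrite /L -addrA lerD//.
    by rewrite lerDl.
  have bL : b * L = 2^-1 by rewrite /b; field; rewrite gt_eqF.
  rewrite ler_norml => /andP[h1 h2].
  have := ler_wpM2l (ltW b0) h1; have := ler_wpM2l (ltW b0) h2.
  rewrite mulrN bL; lra.
Qed.

Lemma approximable_set_ae E F N : approximable_set E -> measurable F ->
  measurable N -> mu N = 0%E -> (forall x, D x -> ~ N x -> E x <-> F x) ->
  approximable_set F.
Proof.
move=> [mE [cE aE]] mF mN N0 EF; split => //.
have cF : cmeasurable D (fun x => (\1_F x : R)%:C).
  by apply: cmeasurable_real; exact: measurable_indic.
split => // e /aE[p Pp pE]; exists p => //.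
rewrite /enorm2 (@ae_eq_integral _ _ _ mu D
  (fun x => (normc (p x - (\1_E x)%:C) ^+ 2)%:E))//.
- by apply/measurable_EFinP/measurable_normc2/cmeasurableB => //; exact: P_meas.
- by apply/measurable_EFinP/measurable_normc2/cmeasurableB => //; exact: P_meas.
exists N; split => // x /= xN; apply: contrapT => nN; apply: xN => Dx.
congr ((normc (p x - _%:C) ^+ 2)%:E); rewrite !indicE; congr (_%:R).
have [h1 h2] := EF x Dx nN.
by congr nat_of_bool; apply/idP/idP => /set_mem ?; apply/mem_set; tauto.
Qed.

Hypothesis aD : forall E, measurable E -> approximable_set E.

Lemma approximable_nnsfun (s : {nnsfun T >-> R}) :
  approximable (fun x => (s x)%:C).
Proof.
have -> : (fun x => (s x)%:C) =
    (fun x => \sum_(y <- finmap.enum_fset (fset_set (range s)))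
       y%:C * (\1_(s @^-1` [set y]) x)%:C).
  apply/funext => x; rewrite fimfunE fsbig_finite//= rmorph_sum/=.
  by apply: eq_bigr => y _; rewrite rmorphM.
move: (finmap.enum_fset _) => r; elim: r => [|y r IH].
  under eq_fun do rewrite big_nil; exact: approximable_cst.
under eq_fun do rewrite big_cons; apply: approximableD => //.
apply: approximableM; last by have [] := aD (measurable_sfunP s (measurable_set1 y)).
  exact/cbounded_mem/P_cst.
exact: approximable_cst.
Qed.

Lemma approximable_ge0 (u : T -> R) : measurable_fun D u ->
  (forall x, 0 <= u x) -> mu.-integrable D (EFin \o (fun x => u x ^+ 2)) ->
  approximable (fun x => (u x)%:C).
Proof.
move=> mu_ u0 iu; have mEu : measurable_fun D (EFin \o u) by exact/measurable_EFinP.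
have Eu0 x : D x -> (0 <= (EFin \o u) x)%E by move=> _; rewrite lee_fin.
apply: (@approximable_lim (fun n x => (nnsfun_approx mD mEu n x)%:C) _
                          (fun x => u x ^+ 2)) => //.
- by move=> n; exact: approximable_nnsfun.
- move=> n x Dx; rewrite -rmorphB normc_realc real_normK ?num_real//.
  have := @le_approx _ _ _ D _ n x Eu0 Dx; rewrite lee_fin.
  rewrite -(nnsfun_approxE mD mEu) => su.
  have s0 : 0 <= nnsfun_approx mD mEu n x by [].
  nra.
- move=> x Dx; rewrite (_ : (fun n => _) =
      (fun n => `|nnsfun_approx mD mEu n x - u x|)); last first.
    by apply/funext => n; rewrite -rmorphB normc_realc.
  apply/norm_cvg0P; rewrite -(subrr (u x)).
  apply: cvgB; last exact: cvg_cst.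
  under eq_cvg do rewrite nnsfun_approxE.
  exact: (cvg_approx Eu0 Dx (ltry _)).
Qed.

Lemma approximable_real (u : T -> R) : measurable_fun D u ->
  mu.-integrable D (EFin \o (fun x => u x ^+ 2)) ->
  approximable (fun x => (u x)%:C).
Proof.
move=> mu_ iu.
have H (v : T -> R) : measurable_fun D v -> (forall x, 0 <= v x) ->
    (forall x, v x <= `|u x|) -> approximable (fun x => (v x)%:C).
  move=> mv v0 vu; apply: approximable_ge0 => //.
  apply: le_integrable iu => //.
    by apply/measurable_EFinP; exact: measurable_funX.
  move=> x _ /=; rewrite lee_fin !ger0_norm ?sqr_ge0//.
  by rewrite -[leRHS]real_normK ?num_real// ler_sqr ?nnegrE.
have -> : (fun x => (u x)%:C) = (fun x => (u^\+ x)%:C + (-1) * (u^\- x)%:C).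
  apply/funext => x; rewrite mulN1r -rmorphB; congr (_%:C).
  by rewrite -[in LHS](funrposBneg u).
apply: approximableD.
  apply: H; first exact: measurable_funrpos.
  - by move=> x; exact: funrpos_ge0.
  - by move=> x; rewrite /funrpos ge_max ler_norm normr_ge0.
apply: approximableM; [exact/cbounded_mem/P_cst|exact: approximable_cst|].
apply: H; first exact: measurable_funrneg.
- by move=> x; exact: funrneg_ge0.
- by move=> x; rewrite /funrneg ge_max normr_ge0 andbT -normrN ler_norm.
Qed.

Lemma approximable_square_integrable g :
  square_integrable mu D g -> approximable g.
Proof.
move=> sg; have [[m1 m2] _] := sg; have ig := square_integrable_normc2 sg.
have -> : g = (fun x => (complex.Re (g x))%:C + 'i%C * (complex.Im (g x))%:C).
  by apply/funext => x; rewrite -complexE.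
apply: approximableD; last first.
  apply: approximableM; [exact/cbounded_mem/P_cst|exact: approximable_cst|].
  apply: approximable_real => //; apply: le_integrable ig => //.
    by apply/measurable_EFinP; exact: measurable_funX.
  move=> x _ /=; rewrite lee_fin !ger0_norm ?sqr_ge0// normc_sqr.
  by rewrite lerDr sqr_ge0.
apply: approximable_real => //; apply: le_integrable ig => //.
  by apply/measurable_EFinP; exact: measurable_funX.
move=> x _ /=; rewrite lee_fin !ger0_norm ?sqr_ge0// normc_sqr.
by rewrite lerDl sqr_ge0.
Qed.

End Closure.

(** * Density of trigonometric polynomials on the square *)
Section Characters.
Variable R : realType.
Implicit Types k l : int * int.
Local Notation plane := (measurableTypeR R * measurableTypeR R)%type.
Local Notation Q := (@square R : set plane).

Lemma expiD (a b : R) : expi (a + b) = expi a * expi b.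
Proof.
apply/eqP; rewrite eq_complex /= cosD sinD; apply/andP; split; apply/eqP; ring.
Qed.

Lemma expiN (a : R) : expi (- a) = (expi a)^*.
Proof. by rewrite /expi /= cosN sinN. Qed.

Lemma expi0 : expi (0 : R) = 1.
Proof. by rewrite /expi cos0 sin0. Qed.

Lemma normc_expi (a : R) : normc (expi a) = 1.
Proof. by rewrite /= cos2Dsin2 sqrtr1. Qed.

Definition character k (x : R * R) : R[i] :=
  expi (k.1%:~R * x.1 + k.2%:~R * x.2).

Lemma characterD k l x : character (k + l) x = character k x * character l x.
Proof.
rewrite /character -expiD; congr expi; rewrite /= !intrD; ring.
Qed.

Lemma character0 x : character 0 x = 1.
Proof. by rewrite /character /= !mul0r addr0 expi0. Qed.

Lemma normc_character k x : normc (character k x) = 1.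
Proof. exact: normc_expi. Qed.

Lemma measurable_square : measurable Q.
Proof. by apply: measurableX; exact: measurable_itv. Qed.

Lemma lebesgue2_square : lebesgue2 (@square R) = ((2 * pi) ^+ 2)%:E.
Proof.
pose I := `[- pi, pi]%classic : set R.
transitivity (lebesgue_measure I * lebesgue_measure I)%E.
  by apply: product_measure1E; exact: measurable_itv.
rewrite /I !lebesgue_measure_itv/= lte_fin gtrN ?pi_gt0// -EFinB -EFinM.
by congr EFin; ring.
Qed.

Lemma lebesgue2_square_lty : (lebesgue2 (@square R) < +oo)%E.
Proof. by rewrite lebesgue2_square ltry. Qed.

Lemma measurable_phase k : measurable_fun setT
  (fun x : plane =>
     k.1%:~R * x.1 + k.2%:~R * x.2 : R).
Proof.
apply: measurable_funD; apply: measurable_funM => //; exact: measurable_cst.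
Qed.

Lemma measurable_comp_phase (F : R -> R) k : continuous F ->
  measurable_fun setT
    (fun x : plane =>
       F (k.1%:~R * x.1 + k.2%:~R * x.2)).
Proof.
move=> cF.
exact: (measurableT_comp (continuous_measurable_fun cF) (measurable_phase k)).
Qed.

Lemma cmeasurable_character k : cmeasurable Q (character k).
Proof.
split; apply: measurable_funTS.
  exact: measurable_comp_phase (@continuous_cos R).
exact: measurable_comp_phase (@continuous_sin R).
Qed.

Definition trig_poly : set (R * R -> R[i]) :=
  [set p | exists s : seq ((int * int) * R[i]),
     p = fun x => \sum_(a <- s) a.2 * character a.1 x].

Lemma bounded_algebra_trig : bounded_algebra Q trig_poly.
Proof.
split.
- move=> c; exists [:: (0, c)]; apply/funext => x.
  by rewrite big_seq1 character0 mulr1.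
- move=> _ _ [s ->] [t ->]; exists (s ++ t); apply/funext => x.
  by rewrite big_cat.
- move=> _ _ [s ->] [t ->].
  exists [seq (a.1 + b.1, a.2 * b.2) | a <- s, b <- t]; apply/funext => x.
  rewrite big_allpairs_dep big_distrl; apply: eq_bigr => a _ /=.
  rewrite big_distrr; apply: eq_bigr => b _ /=.
  by rewrite characterD mulrACA.
- move=> _ [s ->]; apply: cmeasurable_sum => a.
  by apply: cmeasurableM; [exact: cmeasurable_cst|exact: cmeasurable_character].
- move=> _ [s ->]; exists (\sum_(a <- s) normc a.2) => x _.
  elim: s => [|a s IH]; first by rewrite !big_nil normc0.
  rewrite !big_cons; apply: le_trans (le_normcD _ _) _.
  by rewrite lerD// normcM normc_character mulr1.
Qed.

Notation appr := (approximable (@lebesgue2 R) Q trig_poly).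
Notation appr_set := (approximable_set (@lebesgue2 R) Q trig_poly).

Let PA := bounded_algebra_trig.
Let mQ := measurable_square.
Let muQ := lebesgue2_square_lty.

Lemma approximable_cos k :
  appr (fun x => (cos (k.1%:~R * x.1 + k.2%:~R * x.2))%:C).
Proof.
apply: (approximable_mem _ PA); exists [:: (k, 2^-1); (- k, 2^-1)].
apply/funext => x; rewrite big_cons big_seq1 /= -mulrDr.
have -> : character (- k) x = (character k x)^*.
  by rewrite -expiN; congr expi; rewrite /= !mulrNz; ring.
rewrite addcJ /= mulrA mulVf ?mul1r// pnatr_eq0//.
Qed.

Lemma approximable_sin k :
  appr (fun x => (sin (k.1%:~R * x.1 + k.2%:~R * x.2))%:C).
Proof.
apply: (approximable_mem _ PA).
exists [:: (k, (2 * 'i%C)^-1); (- k, - (2 * 'i%C)^-1)].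
apply/funext => x; rewrite big_cons big_seq1 /= mulNr -mulrBr.
have -> : character (- k) x = (character k x)^*.
  by rewrite -expiN; congr expi; rewrite /= !mulrNz; ring.
rewrite subcJ /= (mulrAC 2) mulrA mulVf ?mul1r// mulf_neq0// ?pnatr_eq0//.
by apply/eqP => /(congr1 (@complex.Im R)) /= /eqP; rewrite oner_eq0.
Qed.

Section Coordinate.
Variable pr : plane -> R.
Hypothesis mpr : measurable_fun setT pr.
Hypothesis cos_pr : appr (fun x => (cos (pr x))%:C).
Hypothesis sin_pr : appr (fun x => (sin (pr x))%:C).
Hypothesis prQ : forall x, Q x -> - pi <= pr x <= pi.
Hypothesis pr0 : lebesgue2 (pr @^-1` [set - pi]) = 0%E.

Let mcos : measurable_fun setT (fun x => cos (pr x)).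
Proof. exact: (measurableT_comp (continuous_measurable_fun (@continuous_cos R)) mpr). Qed.

Let msin : measurable_fun setT (fun x => sin (pr x)).
Proof. exact: (measurableT_comp (continuous_measurable_fun (@continuous_sin R)) mpr). Qed.

(** Trigonometric polynomials do not separate the sides pr = -pi and pr = pi of
    the square, so the half-plane can only be matched with level sets off the line
    pr = -pi, which is null. *)
Lemma approximable_half_plane a : appr_set [set x | pr x < a].
Proof.
have mS : measurable [set x | pr x < a].
  rewrite -[X in measurable X]setTI.
  exact: (mpr measurableT (measurable_itv `]-oo, a[)).
have mN : measurable (pr @^-1` [set - pi]).
  by rewrite -[X in measurable X]setTI; exact: (mpr measurableT (measurable_set1 _)).
have cos1 x : `|cos (pr x)| <= 1 by rewrite ler_norml cos_geN1 cos_le1.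
have sin1 x : `|sin (pr x)| <= 1 by rewrite ler_norml sin_geN1 sin_le1.
have aS := approximable_lt mQ muQ PA 0 msin sin_pr sin1.
have aC c := approximable_lt mQ muQ PA c mcos cos_pr cos1.
have aC' c : appr_set [set x | c < cos (pr x)].
  have -> : [set x | c < cos (pr x)] = [set x | - cos (pr x) < - c].
    by apply/seteqP; split => x /=; rewrite ltrN2.
  apply: (approximable_lt mQ muQ PA (K := 1)).
  - exact: measurable_funN.
  - under eq_fun do rewrite rmorphN -mulN1r.
    apply: approximableM => //.
      exact/(cbounded_mem PA)/(ba_cst PA).
    exact: approximable_cst.
  - by move=> x; rewrite normrN.
have sin_lt0 t : - pi < t <= pi -> (sin t < 0) = (t < 0) :> bool.
  move=> /andP[t1 t2]; have [t0|t0] := ltP t 0.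
    by rewrite -oppr_gt0 -sinN sin_gt0_pi// oppr_gt0 t0 ltrNl.
  by apply/negbTE; rewrite -leNgt; apply: sin_ge0_pi; rewrite t0.
have [aN|aN] := leP a (- pi).
  apply: (approximable_set_ae mQ PA (approximable_set0 _ PA) mS mN pr0) => x Qx _.
  split=> //=; rewrite ltNge => /negP; apply.
  by apply: (le_trans aN); case/andP: (prQ Qx).
have [aP|aP] := ltP pi a.
  have aT : appr_set setT by rewrite -setC0; apply: approximable_setC => //;
    exact: approximable_set0.
  apply: (approximable_set_ae mQ PA aT mS mN pr0) => x Qx _.
  split=> //= _; by apply: le_lt_trans aP; case/andP: (prQ Qx).
have [a0|a0] := leP a 0.
  apply: (approximable_set_ae mQ PA (approximable_setI mQ PA aS (aC (cos a))) mS mN pr0).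
  move=> x Qx xN; have /andP[x1 x2] := prQ Qx.
  have {}x1 : - pi < pr x by rewrite lt_neqAle x1 andbT; apply/eqP => /esym.
  rewrite /= sin_lt0 ?x1//.
  have C : pr x < 0 -> (cos (pr x) < cos a) = (pr x < a).
    move=> x0; rewrite -(cosN (pr x)) -(cosN a) ltr_cos ?ltrN2// in_itv/= oppr_ge0.
      by rewrite a0 lerNl ltW.
    by rewrite (ltW x0) lerNl ltW.
  split=> [[x0]|xa]; first by rewrite C.
  have x0 : pr x < 0 by exact: lt_le_trans a0.
  by rewrite C.
apply: (approximable_set_ae mQ PA (approximable_setU mQ PA aS (aC' (cos a))) mS mN pr0).
move=> x Qx xN; have /andP[x1 x2] := prQ Qx.
have {}x1 : - pi < pr x by rewrite lt_neqAle x1 andbT; apply/eqP => /esym.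
rewrite /= sin_lt0 ?x1//.
have C : 0 <= pr x -> (cos a < cos (pr x)) = (pr x < a).
  by move=> x0; rewrite ltr_cos// in_itv/= ?x0 ?x2 ?(ltW a0).
have [x0|x0] := ltP (pr x) 0; last by rewrite C//; split => [[]//|]; right.
by split => _; [exact: lt_trans a0|left].
Qed.

Lemma approximable_preimage (A : set (measurableTypeR R)) : measurable A ->
  appr_set (pr @^-1` A).
Proof.
move=> mA; pose S := [set B : set R | appr_set (pr @^-1` B)].
have [S0 SC SU] := sigma_algebra_approximable (mu := @lebesgue2 R) mQ muQ PA.
have sS : sigma_algebra setT S.
  split; first by rewrite /S /= preimage_set0.
  - by move=> B SB; rewrite /S /= setTD preimage_setC -setTD; exact: SC.
  - by move=> F SF; rewrite /S /= preimage_bigcup; exact: SU.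
have : <<s @RGenInftyO.G R >> `<=` S.
  apply: smallest_sub => //.
  move=> _ [a ->]; rewrite /S /=.
  have -> : pr @^-1` `]-oo, a[ = [set x | pr x < a].
    by apply/seteqP; split => x /=; rewrite in_itv.
  exact: approximable_half_plane.
apply; move: mA; rewrite /measurable/=.
by have := @RGenInftyO.measurableE R; rewrite /measurable /= => ->.
Qed.

End Coordinate.

Lemma approximable_measurable (E : set plane) : measurable E -> appr_set E.
Proof.
rewrite measurable_prod_measurableType; apply: smallest_sub.
  exact: sigma_algebra_approximable.
move=> _ [A mA [B mB <-]].
have -> : A `*` B = (fst @^-1` A) `&` (snd @^-1` B) by [].
apply: approximable_setI => //.
- apply: approximable_preimage => //.
  + have := approximable_cos (1, 0); congr (appr _).
    by apply/funext => x /=; rewrite mul1r mul0r addr0.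
  + have := approximable_sin (1, 0); congr (appr _).
    by apply/funext => x /=; rewrite mul1r mul0r addr0.
  + by move=> x [/=]; rewrite in_itv.
  + have -> : fst @^-1` [set - pi] = [set - pi] `*` setT :> set plane.
      by apply/seteqP; split => x //= [].
    pose N : set R := [set - pi].
    transitivity (lebesgue_measure N * (@lebesgue_measure R setT))%E.
      exact: product_measure1E.
    by rewrite lebesgue_measure_set1 mul0e.
- apply: approximable_preimage => //.
  + have := approximable_cos (0, 1); congr (appr _).
    by apply/funext => x /=; rewrite mul1r mul0r add0r.
  + have := approximable_sin (0, 1); congr (appr _).
    by apply/funext => x /=; rewrite mul1r mul0r add0r.
  + by move=> x [_ /=]; rewrite in_itv.
  + have -> : snd @^-1` [set - pi] = setT `*` [set - pi] :> set plane.
      by apply/seteqP; split => x //= [].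
    pose N : set R := [set - pi].
    transitivity ((@lebesgue_measure R setT) * lebesgue_measure N)%E.
      exact: product_measure1E.
    by rewrite lebesgue_measure_set1 mule0.
Qed.

Lemma trig_poly_dense f (e : R) : L2 f -> 0 < e ->
  exists2 p, trig_poly p &
    (enorm2 lebesgue2 Q (fun x => (p x - f x)%R) < e%:E)%E.
Proof.
move=> [m1 m2 fi] e0.
have [_] := approximable_square_integrable mQ PA approximable_measurable
  (conj (conj m1 m2) fi : square_integrable (@lebesgue2 R) Q f).
exact.
Qed.

End Characters.

(** * Distance to a combination of orthonormal functions *)
Section OrthonormalDistance.
Context d (T : measurableType d) (R : realType).
Variables (mu : {measure set T -> \bar R}) (D : set T) (mD : measurable D).
Implicit Types f g h : T -> R[i].
Local Notation sqint := (square_integrable mu D).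
Local Notation ip f g := (cintegral mu D (fun x => f x * (g x)^*)).

Lemma conjc_realM (r : R) (z : R[i]) : (r%:C * z)^* = r%:C * z^*.
Proof.
case: z => a b; apply/eqP; rewrite eq_complex/= !mul0r.
by apply/andP; split; apply/eqP; ring.
Qed.

Lemma square_integrableD f g : sqint f -> sqint g -> sqint (fun x => f x + g x).
Proof.
move=> [mf ff] [mg fg]; split; first exact: cmeasurableD.
apply: (le_lt_trans (enorm2D mu mD mf mg)).
by apply: lte_add_pinfty; rewrite lte_mul_pinfty ?lee_fin.
Qed.

Lemma square_integrableZ c f : sqint f -> sqint (fun x => c * f x).
Proof.
move=> [mf ff]; have mcf : cmeasurable D (fun x => c * f x).
  by apply: cmeasurableM => //; exact: cmeasurable_cst.
split => //; apply: (@le_lt_trans _ _ (enorm2 mu D (fun x => (normc c)%:C * f x)%R)).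
  apply: le_enorm2 => //; first by apply: cmeasurableM => //; exact: cmeasurable_cst.
  by move=> x _; rewrite !normcM normc_realc ger0_norm ?normc_nneg.
by rewrite enorm2Z// lte_mul_pinfty ?lee_fin ?sqr_ge0.
Qed.

Lemma square_integrable_sum I (s : seq I) (c : I -> R[i]) (e : I -> T -> R[i]) :
  (forall i, sqint (e i)) -> sqint (fun x => \sum_(i <- s) c i * e i x).
Proof.
move=> se; elim: s => [|i s IH].
  under eq_fun do rewrite big_nil.
  split; first exact: cmeasurable_cst.
  rewrite /enorm2; under eq_integral do rewrite normc0 expr0n.
  by rewrite integral0.
under eq_fun do rewrite big_cons.
by apply: square_integrableD => //; exact: square_integrableZ.
Qed.

Lemma inner_suml I (s : seq I) (c : I -> R[i]) (e : I -> T -> R[i]) g :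
  (forall i, sqint (e i)) -> sqint g ->
  ip (fun x => \sum_(i <- s) c i * e i x) g = \sum_(i <- s) c i * ip (e i) g.
Proof.
move=> se sg; under eq_fun do rewrite mulr_suml.
have ie i : cintegrable mu D (fun x => e i x * (g x)^*).
  exact: cintegrable_mulJ.
rewrite (cintegral_sum mD s (F := fun i x => c i * e i x * (g x)^*)); last first.
  move=> i; under eq_fun do rewrite -mulrA; exact: cintegrableZ.
apply: eq_bigr => i _; rewrite -cintegralZ//; congr cintegral.
by apply/funext => x; rewrite mulrA.
Qed.

Lemma innerJ f g : sqint f -> sqint g -> ip g f = (ip f g)^*.
Proof.
move=> sf sg; rewrite -cintegralJ//; last exact: cintegrable_mulJ.
congr cintegral; apply/funext => x.
by rewrite rmorphM/= conjCK mulrC.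
Qed.

Lemma inner_distance f g : sqint f -> sqint g ->
  ip (fun x => f x - g x) (fun x => f x - g x) =
  ip f f - ip f g - ip g f + ip g g.
Proof.
move=> sf sg; have i1 := cintegrable_mulJ mD.
have iN u v : sqint u -> sqint v -> cintegrable mu D (fun x => -1 * (u x * (v x)^*)).
  by move=> su sv; apply: cintegrableZ => //; exact: i1.
have -> : (fun x => (f x - g x) * (f x - g x)^*) = (fun x =>
    (f x * (f x)^* + -1 * (f x * (g x)^*)) +
    (-1 * (g x * (f x)^*) + g x * (g x)^*)).
  by apply/funext => x; rewrite rmorphB/=; ring.
rewrite !cintegralD ?cintegralZ//; try exact: i1; try exact: iN;
  try (apply: cintegrableD => //; (try exact: i1); exact: iN).
by rewrite !mulN1r addrA.
Qed.

Variables (I : eqType) (e : I -> T -> R[i]) (w : R).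
Hypothesis w0 : 0 < w.
Hypothesis se : forall i, sqint (e i).
Hypothesis orth : forall i j, w%:C * ip (e i) (e j) = (i == j)%:R.

(** Expand the square, and complete it in each coefficient c i. *)
Lemma orthonormal_distance f (s : seq I) (c : I -> R[i]) : sqint f -> uniq s ->
  let fhat i := w%:C * ip f (e i) in
  w * Rintegral mu D (fun x => normc (\sum_(i <- s) c i * e i x - f x) ^+ 2) =
  w * Rintegral mu D (fun x => normc (f x) ^+ 2)
  - \sum_(i <- s) normc (fhat i) ^+ 2 + \sum_(i <- s) normc (c i - fhat i) ^+ 2.
Proof.
move=> sf us fhat; have fhatE i : fhat i = w%:C * ip f (e i) by [].
clearbody fhat; pose p x := \sum_(i <- s) c i * e i x.
have sp : sqint p by exact: square_integrable_sum.
apply: complexI; rewrite rmorphD rmorphB !rmorphM/= -!cintegral_normc2//.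
have sumE (z : I -> R[i]) : (\sum_(i <- s) normc (z i) ^+ 2)%:C =
    \sum_(i <- s) z i * (z i)^*.
  by rewrite rmorph_sum; apply: eq_bigr => i _; rewrite mulc_conj.
rewrite inner_distance// !sumE.
have pf : w%:C * ip p f = \sum_(i <- s) c i * (fhat i)^*.
  rewrite inner_suml// mulr_sumr; apply: eq_bigr => i _.
  by rewrite fhatE conjc_realM -innerJ// mulrCA.
have fp : w%:C * ip f p = \sum_(i <- s) (c i)^* * fhat i.
  rewrite innerJ// -conjc_realM pf rmorph_sum.
  by apply: eq_bigr => i _; rewrite rmorphM/= conjCK.
have pp : w%:C * ip p p = \sum_(i <- s) c i * (c i)^*.
  rewrite inner_suml// mulr_sumr; apply: eq_big_seq => i si.
  rewrite mulrCA innerJ// -conjc_realM inner_suml// mulr_sumr.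
  congr (_ * _^*); rewrite (bigD1_seq i)//= big1 => [|j ji].
    by rewrite addr0 mulrCA orth eqxx mulr1.
  by rewrite mulrCA orth (negbTE ji) mulr0.
rewrite mulrDr !mulrBr pp pf fp.
have -> : \sum_(i <- s) (c i - fhat i) * (c i - fhat i)^* =
    \sum_(i <- s) c i * (c i)^* - \sum_(i <- s) c i * (fhat i)^* -
    \sum_(i <- s) (c i)^* * fhat i + \sum_(i <- s) fhat i * (fhat i)^*.
  rewrite -!sumrB -big_split/=; apply: eq_bigr => i _.
  by rewrite rmorphB/=; ring.
ring.
Qed.

End OrthonormalDistance.

(** * Orthonormality of the characters *)
Section Orthogonality.
Variable R : realType.
Implicit Types k l : int * int.
Local Notation plane := (measurableTypeR R * measurableTypeR R)%type.
Local Notation Q := (@square R : set plane).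

Lemma periodic_int (G : R -> R) (T : R) : periodic G T ->
  forall x (m : int), G (x + m%:~R * T) = G x.
Proof.
move=> GT x [n|n]; first by rewrite mulr_natl periodicn.
rewrite NegzE rmorphN mulNr.
rewrite -[LHS](periodicn GT n.+1); congr G.
by rewrite -mulr_natl subrK.
Qed.

Lemma integral_periodic_derivative (F G : R -> R) (a : R) (m : int) :
  m != 0 -> continuous F -> (forall x : R, is_derive x 1 G (F x)) ->
  periodic G (pi *+ 2) ->
  (\int[lebesgue_measure]_(y in `[(- pi)%R, pi%R]) (F (a + m%:~R * y))%:E = 0)%E.
Proof.
move=> m0 cF dG perG.
have m0' : m%:~R != 0 :> R by rewrite intr_eq0.
pose A (y : R) := a + m%:~R * y.
have dA (y : R) : is_derive y 1 A m%:~R.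
  rewrite /A; have := is_deriveD (is_derive_cst a y 1)
    (is_deriveZ m%:~R (is_derive_id y 1)).
  by rewrite add0r scaler1.
pose H (y : R) := m%:~R^-1 * G (A y).
have dH (y : R) : is_derive y 1 H (F (A y)).
  have := is_deriveZ m%:~R^-1 (is_derive1_comp (dG (A y)) (dA y)).
  by rewrite /GRing.scale/= mulrC mulfK.
have cH : continuous H.
  by move=> y; apply: differentiable_continuous; apply/derivable1_diffP; case: (dH y).
rewrite (@continuous_FTC2 _ (fun y => F (A y)) H).
- rewrite -EFinB /H; congr EFin; rewrite -mulrBr.
  have -> : A pi = A (- pi) + m%:~R * (pi *+ 2) by rewrite /A -mulr_natl; ring.
  by rewrite periodic_int// subrr mulr0.
- by rewrite gtrN// pi_gt0.
- apply: continuous_subspaceT => y; apply: continuous_comp; last exact: cF.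
  by apply: differentiable_continuous; apply/derivable1_diffP; case: (dA y).
- split.
  + by move=> y _; case: (dH y).
  + by apply: cvg_at_right_filter; exact: cH.
  + by apply: cvg_at_left_filter; exact: cH.
- by move=> y _; rewrite derive1E; case: (dH y).
Qed.

Local Notation I := (`[- pi, pi]%classic : set R).

Lemma integral_square_sections (F : plane -> R) :
  lebesgue2.-integrable Q (EFin \o F) ->
  (forall x, I x -> \int[lebesgue_measure]_(y in I) (F (x, y))%:E = 0)%E \/
  (forall y, I y -> \int[lebesgue_measure]_(x in I) (F (x, y))%:E = 0)%E ->
  Rintegral lebesgue2 Q F = 0.
Proof.
move=> /(integrable_mkcond _ (@measurable_square R)) iF h; rewrite /Rintegral.
rewrite integral_mkcond; case: h => h.
  rewrite [X in fine X](_ : _ = 0%E)//.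
  rewrite -[LHS](integral12_prod_meas1 iF) integral0_eq// => x _.
  rewrite /fubini_F; have [xI|xI] := pselect (I x).
    rewrite -[RHS](h x xI) [RHS]integral_mkcond; apply: eq_integral => y _.
    rewrite /patch; congr (if _ then _ else _).
    by apply/idP/idP => /set_mem H; apply/mem_set; [case: H|split].
  rewrite integral0_eq// => y _; rewrite /patch memNset// => -[] //.
rewrite [X in fine X](_ : _ = 0%E)//.
rewrite -[LHS](integral21_prod_meas1 iF) integral0_eq// => y _.
rewrite /fubini_G; have [yI|yI] := pselect (I y).
  rewrite -[RHS](h y yI) [RHS]integral_mkcond; apply: eq_integral => x _.
  rewrite /patch; congr (if _ then _ else _).
  by apply/idP/idP => /set_mem H; apply/mem_set; [case: H|split].
rewrite integral0_eq// => x _; rewrite /patch memNset// => -[] //.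
Qed.

Lemma integrable_phase (F : R -> R) k : continuous F -> (forall x, `|F x| <= 1) ->
  lebesgue2.-integrable Q (EFin \o (fun x => F (k.1%:~R * x.1 + k.2%:~R * x.2))).
Proof.
move=> cF F1; apply: measurable_bounded_integrable.
- exact: measurable_square.
- exact: lebesgue2_square_lty.
- apply: measurable_funTS; exact: measurable_comp_phase.
- exists 1; split; first exact: num_real.
  by move=> M M1 x _ /=; apply: le_trans (F1 _) (ltW M1).
Qed.

(** Integrate first in a variable whose frequency is not zero. *)
Lemma integral_phase (F G : R -> R) k : k != 0 ->
  continuous F -> (forall x, `|F x| <= 1) -> (forall x : R, is_derive x 1 G (F x)) ->
  periodic G (pi *+ 2) ->
  Rintegral lebesgue2 Q (fun x => F (k.1%:~R * x.1 + k.2%:~R * x.2)) = 0.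
Proof.
move=> k0 cF F1 dG perG; apply: integral_square_sections.
  exact: integrable_phase.
have [k20|k20] := eqVneq k.2 0.
  have k10 : k.1 != 0.
    by apply: contra k0 => /eqP k10; rewrite [k]surjective_pairing k10 k20.
  right => y _.
  rewrite -[RHS](integral_periodic_derivative (k.2%:~R * y) k10 cF dG perG).
  by apply: eq_integral => x _; rewrite addrC.
left => x _.
exact: (integral_periodic_derivative (k.1%:~R * x) k20 cF dG perG).
Qed.

Lemma is_derive_Ncos (x : R) : is_derive x 1 (\- cos) (sin x).
Proof. by have := is_deriveN (is_derive_cos x); rewrite opprK. Qed.

Lemma cintegral_character k :
  cintegral lebesgue2 Q (character k) = ((2 * pi) ^+ 2 * (k == 0)%:R)%:C.
Proof.
have [->|k0] := eqVneq k 0.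
  rewrite (_ : character 0 = fun=> 1); last by apply/funext => x; rewrite character0.
  rewrite /cintegral /= !Rintegral_cst ?mul0r ?mul1r ?mulr1; try exact: measurable_square.
  by rewrite lebesgue2_square.
rewrite mulr0 /cintegral; congr (_ +i* _).
  apply: (@integral_phase _ sin) => //; first exact: continuous_cos.
    by move=> x; rewrite ler_norml cos_geN1 cos_le1.
  exact: sinD2pi.
apply: (@integral_phase _ (\- cos)) => //; first exact: continuous_sin.
- by move=> x; rewrite ler_norml sin_geN1 sin_le1.
- exact: is_derive_Ncos.
- by move=> x; rewrite /= cosD2pi.
Qed.

Lemma square_integrable_character k : square_integrable lebesgue2 Q (character k).
Proof.
split; first exact: cmeasurable_character.
rewrite /enorm2; under eq_integral do rewrite normc_character expr1n.
by rewrite integral_cst ?mul1e; [exact: lebesgue2_square_lty|exact: measurable_square].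
Qed.

Lemma orthonormal_character k l :
  ((2 * pi)^-1 ^+ 2)%:C *
  cintegral lebesgue2 Q (fun x => character k x * (character l x)^*) = (k == l)%:R.
Proof.
have -> : (fun x : plane => character k x * (character l x)^*) = character (k - l).
  apply: funext => x; rewrite characterD; congr (_ * _).
  by rewrite /character -expiN; congr expi; rewrite /= !mulrNz; ring.
rewrite cintegral_character subr_eq0 -rmorphM mulrA -exprMn mulVf; last first.
  by rewrite mulf_neq0// gt_eqF// pi_gt0.
by rewrite expr1n mul1r rmorph_nat.
Qed.

End Orthogonality.

(** * Parseval's inequality and truncation *)
Section FourierTruncation.
Variable R : realType.
Implicit Types (k l : int * int) (f : R * R -> R[i]).
Local Notation plane := (measurableTypeR R * measurableTypeR R)%type.
Local Notation Q := (@square R : set plane).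
Local Notation w := ((2 * pi)^-1 ^+ 2 : R).

Lemma weight_gt0 : 0 < w.
Proof. by rewrite exprn_gt0// invr_gt0 mulr_gt0// pi_gt0. Qed.

Lemma fourier_coefE f k : fourier_coef f k =
  w%:C * cintegral (@lebesgue2 R) Q (fun x => f x * (character k x)^*).
Proof.
rewrite /fourier_coef; congr (_ * _); rewrite /cintegral /integral_square.
by congr (_ +i* _); apply: eq_Rintegral => x _; rewrite expiN.
Qed.

Lemma norm_L2_sqr f : norm_L2 f ^+ 2 =
  w * Rintegral lebesgue2 Q (fun x => normc (f x) ^+ 2).
Proof.
rewrite /norm_L2 sqr_sqrtr// mulr_ge0 ?(ltW weight_gt0)//.
by apply: Rintegral_ge0 => x _; exact: sqr_ge0.
Qed.

Lemma norm_L2_distance (I : eqType) (phi : I -> int * int) f (s : seq I)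
    (c : I -> R[i]) : injective phi -> L2 f -> uniq s ->
  norm_L2 (fun x => \sum_(i <- s) c i * character (phi i) x - f x) ^+ 2 =
  norm_L2 f ^+ 2 - \sum_(i <- s) normc (fourier_coef f (phi i)) ^+ 2
  + \sum_(i <- s) normc (c i - fourier_coef f (phi i)) ^+ 2.
Proof.
move=> phiI [m1 m2 ff] us; rewrite !norm_L2_sqr.
have sf : square_integrable (@lebesgue2 R) Q f by [].
have orth i j : w%:C * cintegral lebesgue2 Q
    (fun x => character (phi i) x * (character (phi j) x)^*) = (i == j)%:R.
  by rewrite orthonormal_character (inj_eq phiI).
rewrite (orthonormal_distance (@measurable_square R) (e := fun i => @character R (phi i))
  (fun i => square_integrable_character R (phi i)) orth c sf us).
under eq_bigr do rewrite -fourier_coefE.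
by under [X in _ - _ + X]eq_bigr do rewrite -fourier_coefE.
Qed.

Lemma character_sumE (t : seq ((int * int) * R[i])) x :
  \sum_(a <- t) a.2 * character a.1 x =
  \sum_(k <- undup [seq a.1 | a <- t])
     (\sum_(a <- t | a.1 == k) a.2) * character k x.
Proof.
under [RHS]eq_bigr do rewrite mulr_suml big_mkcond.
rewrite exchange_big/=; apply: eq_big_seq => a at_.
rewrite (bigD1_seq a.1) ?undup_uniq//=; last first.
  by rewrite mem_undup map_f.
rewrite eqxx big1 ?addr0// => k /negbTE ka.
by rewrite eq_sym ka.
Qed.

(** By [trig_poly_dense] some trigonometric polynomial is within eps of f in
    squared norm; by [norm_L2_distance] this is at least |f|^2 minus the mass of
    the coefficients of f at the frequencies of that polynomial. *)
Lemma parseval_le f (eps : R) : L2 f -> 0 < eps ->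
  exists2 s : seq (int * int), uniq s &
    norm_L2 f ^+ 2 <= \sum_(k <- s) normc (fourier_coef f k) ^+ 2 + eps.
Proof.
move=> Lf e0; have ew0 : 0 < eps / w by rewrite divr_gt0// weight_gt0.
have [_ [t ->] pe] := trig_poly_dense Lf ew0.
pose s := undup [seq a.1 | a <- t]; exists s; first exact: undup_uniq.
pose c k := \sum_(a <- t | a.1 == k) a.2.
have := @norm_L2_distance _ id f s c (@inj_id _) Lf (undup_uniq _).
have -> : norm_L2 (fun x => \sum_(i <- s) c i * character (id i) x - f x) ^+ 2 =
    norm_L2 (fun x => \sum_(a <- t) a.2 * character a.1 x - f x) ^+ 2.
  by congr (norm_L2 _ ^+ 2); apply/funext => x; rewrite character_sumE.
have : norm_L2 (fun x => \sum_(a <- t) a.2 * character a.1 x - f x) ^+ 2 < eps.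
  rewrite norm_L2_sqr mulrC -ltr_pdivlMr ?weight_gt0//.
  rewrite -lte_fin; apply: (le_lt_trans _ pe); rewrite /Rintegral fineK//.
  rewrite ge0_fin_numE; last by apply: integral_ge0 => x _; rewrite lee_fin sqr_ge0.
  exact: lt_trans pe (ltry _).
have : 0 <= \sum_(i <- s) normc (c i - fourier_coef f i) ^+ 2.
  by apply: sumr_ge0 => i _; exact: sqr_ge0.
move=> h1 h2 h3; move: h2; rewrite h3; lra.
Qed.

Lemma seminorm_sum_le alpha f (s : seq (int * int)) : sobolev alpha f -> uniq s ->
  \sum_(k <- s) freq_norm k ^+ (2 * alpha) * normc (fourier_coef f k) ^+ 2 <=
  sobolev_seminorm alpha f ^+ 2.
Proof.
move=> [_ sob] us.
have fn0 k : 0 <= freq_norm k ^+ (2 * alpha) :> R by rewrite exprn_ge0// sqrtr_ge0.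
pose a k := (freq_norm k ^+ (2 * alpha) * normc (fourier_coef f k) ^+ 2)%:E.
have a0 k : (0 <= a k)%E by rewrite lee_fin mulr_ge0 ?sqr_ge0.
have S0 : (0 <= \esum_(k in [set: int * int]) a k)%E by exact: esum_ge0.
have Sfin : (\esum_(k in [set: int * int]) a k \is a fin_num)%E.
  rewrite ge0_fin_numE//; apply: le_lt_trans sob; apply: le_esum => k _.
  by rewrite lee_fin ler_wpM2r ?sqr_ge0// lerDr.
rewrite /sobolev_seminorm sqr_sqrtr ?fine_ge0// -lee_fin fineK//.
apply: esum_ge; exists [set` s]; first by split => //; exact: finite_seq.
rewrite -fsbig_seq// -sumEFin le_eqVlt eqxx; exact: isT.
Qed.

Lemma sum_le_notin (I : eqType) (F : I -> R) (s s0 : seq I) :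
  (forall i, 0 <= F i) -> uniq s -> uniq s0 ->
  \sum_(i <- s) F i <=
  \sum_(i <- [seq i <- s | i \notin s0]) F i + \sum_(i <- s0) F i.
Proof.
move=> F0 us us0; rewrite (bigID (mem s0)) addrC lerD ?big_filter//.
rewrite [leRHS](bigID (mem s)) -[leLHS]addr0 lerD ?sumr_ge0//.
rewrite -[leLHS]big_filter -[leRHS]big_filter.
rewrite le_eqVlt; apply/orP; left; apply/eqP/perm_big/uniq_perm.
- exact: filter_uniq.
- exact: filter_uniq.
- by move=> i; rewrite !mem_filter/= andbC.
Qed.

(** At the frequencies outside s0, 1 <= M^(-2 alpha) |k|^(2 alpha). *)
Lemma truncation_error alpha f (M : R) (s0 : seq (int * int)) :
  sobolev alpha f -> 0 < M -> uniq s0 ->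
  (forall k, k \notin s0 -> M <= freq_norm k) ->
  norm_L2 f ^+ 2 - \sum_(k <- s0) normc (fourier_coef f k) ^+ 2 <=
  (M ^- alpha * sobolev_seminorm alpha f) ^+ 2.
Proof.
move=> sob M0 us0 Ms; have [Lf _] := sob.
rewrite lerBlDr; apply/ler_addgt0Pr => eps e0.
have [s us] := parseval_le Lf e0; move=> /le_trans; apply.
rewrite lerD2r.
have F0 k : 0 <= normc (fourier_coef f k) ^+ 2 by exact: sqr_ge0.
apply: (le_trans (sum_le_notin F0 us us0)); rewrite lerD2r.
set s' := [seq k <- s | k \notin s0].
rewrite exprMn exprVn -exprM mulnC ler_pdivlMl ?exprn_gt0//.
apply: le_trans (seminorm_sum_le sob (filter_uniq _ us : uniq s')).
rewrite mulr_sumr big_seq [leRHS]big_seq; apply: ler_sum => k.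
rewrite mem_filter => /andP[ks0 _]; rewrite ler_wpM2r//.
by rewrite lerXn2r ?nnegrE ?(ltW M0) ?sqrtr_ge0// Ms.
Qed.

End FourierTruncation.

(** * The box of frequencies *)
Section Box.
Variable R : realType.

Definition box_freq (I1 I2 : nat) (p : 'I_(2 * I1 + 1) * 'I_(2 * I2 + 1)) :
  int * int := (freq p.1, freq p.2).

Lemma box_freq_inj I1 I2 : injective (@box_freq I1 I2).
Proof.
move=> [i j] [i' j'] [/addIr[/val_inj ->] /addIr[/val_inj ->]] //.
Qed.

Lemma trig_sumE I1 I2 (B : 'M[R[i]]_(2 * I1 + 1, 2 * I2 + 1)) x :
  trig_sum B x =
  \sum_(p : 'I_(2 * I1 + 1) * 'I_(2 * I2 + 1)) B p.1 p.2 * character (box_freq p) x.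
Proof.
rewrite /trig_sum pair_bigA/=; apply: eq_bigr => p _.
by rewrite /character expiD mulrA.
Qed.

Lemma freq_onto I (z : int) : (- I%:Z <= z <= I%:Z)%R ->
  exists i : 'I_(2 * I + 1), freq i = z.
Proof.
move=> zI; have zb : (`|(z + I%:Z)%R| < 2 * I + 1)%N by lia.
by exists (Ordinal zb); rewrite /freq /=; lia.
Qed.

Lemma freq_norm_outside I1 I2 (k : int * int) :
  k \notin [seq box_freq p | p : 'I_(2 * I1 + 1) * 'I_(2 * I2 + 1)] ->
  (minn I1 I2)%:R <= freq_norm k :> R.
Proof.
move=> kn; have big (z : int) (I : nat) : ~~ (- I%:Z <= z <= I%:Z)%R ->
    (minn I1 I2 <= I)%N -> (minn I1 I2)%:R ^+ 2 <= z%:~R ^+ 2 :> R.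
  move=> zI mI; rewrite -[leRHS]real_normK ?num_real// lerXn2r ?nnegrE//.
  by rewrite -intr_norm -[leLHS]/((minn I1 I2)%:Z%:~R) ler_int; lia.
rewrite -[leLHS]ger0_norm// -sqrtr_sqr; apply: ler_wsqrtr.
have [k1|k1] := boolP (- I1%:Z <= k.1 <= I1%:Z); last first.
  by apply: ler_wpDr; [exact: sqr_ge0|exact: big k1 (geq_minl _ _)].
have [k2|k2] := boolP (- I2%:Z <= k.2 <= I2%:Z); last first.
  by apply: ler_wpDl; [exact: sqr_ge0|exact: big k2 (geq_minr _ _)].
have [i ei] := freq_onto k1; have [j ej] := freq_onto k2.
case/negP: kn; apply/mapP; exists (i, j); first by rewrite mem_enum.
by rewrite /box_freq /= ei ej -surjective_pairing.
Qed.

End Box.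

(** The squared distance is the truncation error plus a sum over the entries of
    the coefficient matrix, each of which obeys [max_volume_entry_bound]. *)
Lemma skeleton_fourier_error (R : realType) (alpha : nat) (f : R * R -> R[i])
    (I1 I2 : nat) (J1 : {set 'I_(2 * I1 + 1)}) (J2 : {set 'I_(2 * I2 + 1)})
    (A := fourier_mx f I1 I2) (G := sub_mx A J1 J2)
    (At := cols_mx A J2 *m moore_penrose G *m rows_mx A J1) :
  sobolev alpha f -> (0 < I1)%N -> (0 < I2)%N -> (#|J2| <= #|J1| < 2 * I1 + 1)%N ->
  \rank G = #|J2| ->
  (forall (K1 : {set 'I_(2 * I1 + 1)}) (K2 : {set 'I_(2 * I2 + 1)}),
     #|K1| = #|J1| -> #|K2| = #|J2| -> volume (sub_mx A K1 K2) <= volume G) ->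
  norm_L2 (fun x => trig_sum At x - f x)
    <= (minn I1 I2)%:R ^- alpha * sobolev_seminorm alpha f
       + Num.sqrt (((2 * I1 + 1) * (2 * I2 + 1))%N%:R)
         * Num.sqrt (1 + #|J2|%:R)
         * Num.sqrt (1 + #|J2|%:R / (#|J1|%:R - #|J2|%:R + 1))
         * singular_value #|J2|.+1 A.
Proof.
move=> sob I1_gt0 I2_gt0 J21m rG maxG.
have [Lf _] := sob.
set b := singular_value _ _.
set t := (minn I1 I2)%:R ^- alpha * sobolev_seminorm alpha f.
pose beta := Num.sqrt (1 + #|J2|%:R) *
  Num.sqrt (1 + #|J2|%:R / (#|J1|%:R - #|J2|%:R + 1)) * b.
have entry i j : normc (At i j - A i j) <= beta.
  have := max_volume_entry_bound J21m rG maxG i j.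
  rewrite -normcN [X in normc X](_ : _ = At i j - A i j)//.
  by rewrite [X in - X]mxE [X in _ + X]mxE opprD opprK addrC.
have b0 : 0 <= b by exact: singular_value_ge0.
have beta0 : 0 <= beta by rewrite !mulr_ge0 ?sqrtr_ge0.
have t0 : 0 <= t by rewrite mulr_ge0 ?sqrtr_ge0// invr_ge0 exprn_ge0.
pose mn : R := ((2 * I1 + 1) * (2 * I2 + 1))%N%:R.
have -> : Num.sqrt mn * Num.sqrt (1 + #|J2|%:R) *
    Num.sqrt (1 + #|J2|%:R / (#|J1|%:R - #|J2|%:R + 1)) * b = Num.sqrt mn * beta.
  by rewrite /beta !mulrA.
have -> : norm_L2 (fun x => trig_sum At x - f x) =
    norm_L2 (fun x => \sum_p At p.1 p.2 * character (box_freq p) x - f x).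
  by congr norm_L2; apply: funext => x; rewrite trig_sumE.
have trunc : norm_L2 f ^+ 2 - \sum_(p : 'I_(2 * I1 + 1) * 'I_(2 * I2 + 1))
    normc (fourier_coef f (box_freq p)) ^+ 2 <= t ^+ 2.
  have uF : uniq [seq box_freq p | p : 'I_(2 * I1 + 1) * 'I_(2 * I2 + 1)].
    by rewrite map_inj_uniq ?enum_uniq//; exact: box_freq_inj.
  have M0 : 0 < (minn I1 I2)%:R :> R by rewrite ltr0n leq_min I1_gt0.
  have := truncation_error sob M0 uF (@freq_norm_outside R I1 I2).
  by rewrite big_map big_enum.
have entries : \sum_(p : 'I_(2 * I1 + 1) * 'I_(2 * I2 + 1))
    normc (At p.1 p.2 - fourier_coef f (box_freq p)) ^+ 2 <= mn * beta ^+ 2.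
  have -> : mn * beta ^+ 2 =
      \sum_(p : 'I_(2 * I1 + 1) * 'I_(2 * I2 + 1)) beta ^+ 2.
    by rewrite sumr_const card_prod !card_ord mulr_natl.
  apply: ler_sum => p _; rewrite ler_sqr ?nnegrE ?normc_nneg//.
  by have := entry p.1 p.2; rewrite [A _ _]mxE.
have D := norm_L2_distance (fun p => At p.1 p.2) (@box_freq_inj I1 I2) Lf
  (index_enum_uniq _).
rewrite -ler_sqr; first last.
- by rewrite nnegrE addr_ge0// mulr_ge0// sqrtr_ge0.
- by rewrite nnegrE sqrtr_ge0.
rewrite D; apply: (le_trans (lerD trunc entries)).
have -> : mn * beta ^+ 2 = (Num.sqrt mn * beta) ^+ 2.
  by rewrite [RHS]exprMn sqr_sqrtr.
by rewrite sqrrD lerD2r lerDl mulrn_wge0// mulr_ge0// mulr_ge0// sqrtr_ge0.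
Qed.

End Analysis.

Theorem corollary2 (R : realType) (alpha : nat) (alpha_gt0 : (0 < alpha)%N) :
  exists C : R,
    forall (f : R * R -> R[i]) (I1 I2 : nat),
      sobolev alpha f -> (0 < I1)%N -> (0 < I2)%N ->
    let A := fourier_mx f I1 I2 in
    forall (S1 S2 : nat) (J1 : {set 'I_(2 * I1 + 1)})
           (J2 : {set 'I_(2 * I2 + 1)}),
      (0 < S2)%N -> (S2 <= S1)%N ->
      (S1 < 2 * I1 + 1)%N -> (S2 < 2 * I2 + 1)%N ->
      #|J1| = S1 -> #|J2| = S2 ->
    let G := sub_mx A J1 J2 in
      \rank G = S2 ->
      (forall (K1 : {set 'I_(2 * I1 + 1)}) (K2 : {set 'I_(2 * I2 + 1)}),
         #|K1| = S1 -> #|K2| = S2 -> volume (sub_mx A K1 K2) <= volume G) ->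
    let At := cols_mx A J2 *m moore_penrose G *m rows_mx A J1 in
    norm_L2 (fun x => trig_sum At x - f x)
      <= C * (minn I1 I2)%:R ^- alpha * sobolev_seminorm alpha f
         + Num.sqrt (((2 * I1 + 1) * (2 * I2 + 1))%N%:R)
           * Num.sqrt (1 + S2%:R)
           * Num.sqrt (1 + S2%:R / (S1%:R - S2%:R + 1))
           * singular_value S2.+1 A.
Proof.
exists 1 => f I1 I2 sob I1_gt0 I2_gt0 A S1 S2 J1 J2 _ S21 S1m _ cJ1 cJ2 G rG.
move=> maxG /=; subst S1 S2; rewrite mul1r.
by apply: skeleton_fourier_error => //; rewrite S21.
Qed.
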